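(* Let $\mu$ be a real number with $2\mu\in[0,1]$, and for $\delta\in[0,1/2-\mu]$ and $\lambda\in[0,1]$ put $$E(\mu,\delta)=(\mu+\delta)H\!\left(\frac{\mu}{\mu+\delta}\right)+(1-\mu-\delta)H\!\left(\frac{\mu}{1-\mu-\delta}\right)-H(2\mu),$$ $$G(\mu,\lambda)=(1-2\mu)\log2+H(2\mu)-(4\mu-1)H\!\left(\frac{\lambda}{4\mu-1}\right)-(2-4\mu)H\!\left(\frac{2\mu-\lambda}{2-4\mu}\right)+\lambda\log\!\left(\frac2\pi\right).$$ (1) Suppose $\delta\in[0,1/2-\mu]$ and $\lambda\in[0,1]$ satisfy $E(\mu,\delta)+G(\mu,\lambda)<0$. Then for every $\varepsilon>0$ there exist $\eta>0$ and $M$ such that for all integers $m\ge M$ for which $n=2\mu m$ is an integer, all primes $p$, all MDS generator matrices $B\in\mathbb{F}_p^{m\times n}$, and all sets $S_1,\dots,S_m\subseteq\mathbb{F}_p$ with $\bigl||S_i|/p-1/2\bigr|\le\eta$ for every $i$, there exists $x\in\mathbb{F}_p^n$ with $$s(x)\ge\mathrm{SCL}_{1/2}(\mu+\delta)-\varepsilon.$$ (2) Solving for the minimizer $\lambda_\star$ of $\lambda\mapsto G(\mu,\lambda)$ gives $$\lambda_\star=\frac{A-\sqrt{A^2-8(1-2/\pi)\mu(4\mu-1)}}{2(1-2/\pi)},\qquad A=\frac2\pi+\left(1-\frac2\pi\right)(6\mu-1).$$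
   Context: A matrix $B\in\mathbb{F}_p^{m\times n}$ with $n\le m$ is an MDS generator matrix if any $n$ of its rows are linearly independent. Given $B$ and sets $S_1,\dots,S_m\subseteq\mathbb{F}_p$, the satisfaction ratio of $x\in\mathbb{F}_p^n$ is $s(x)=\frac1m\left|\{i\in\{1,\dots,m\}:(Bx)_i\in S_i\}\right|$. $H(x)=-x\log x-(1-x)\log(1-x)$ for $x\in[0,1]$ with $H(0)=H(1)=0$, natural logarithm; $H$ is undefined outside $[0,1]$, and parameters appearing in arguments of $H$ (such as $\lambda$ here) implicitly range only over values for which all arguments of $H$ lie in $[0,1]$. A term of the form $0\cdot H(0/0)$ is read as $0$. $\mathrm{SCL}_{1/2}(\alpha)=\frac12+\sqrt{\alpha(1-\alpha)}$ for $\alpha\in[0,1/2]$ and $\mathrm{SCL}_{1/2}(\alpha)=1$ for $\alpha\ge1/2$.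
   Formalization: Part (2) is stated only for μ=0 or 1/4≤μ≤1/2: for 0<μ<1/4 the only admissible λ in [0,1] is λ=0, while the displayed formula for λ⋆ is negative, so the claim fails there. *)

(* Defs.v *)
From mathcomp Require Import all_boot all_order all_algebra.
From mathcomp Require Import reals exp trigo.

Set Implicit Arguments.
Unset Strict Implicit.
Unset Printing Implicit Defensive.

Import Order.TTheory GRing.Theory Num.Theory.

Local Open Scope ring_scope.

Definition is_MDS (F : fieldType) (m n : nat) (B : 'M[F]_(m, n)) : Prop :=
  (n <= m)%N /\ forall f : 'I_n -> 'I_m, injective f -> row_free (rowsub f B).

Definition sat_ratio (R : realType) (F : finFieldType) (m n : nat)
    (B : 'M[F]_(m, n)) (S : 'I_m -> {set F}) (x : 'cV[F]_n) : R :=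
  #|[set i : 'I_m | (B *m x) i ord0 \in S i]|%:R / m%:R.

(* The values H(0) = H(1) = 0 need no separate clause, since 0 * ln 0 = 0
   and ln 1 = 0. The formula is meaningful only for x in [0, 1]. *)
Definition H (R : realType) (x : R) : R :=
  - x * ln x - (1 - x) * ln (1 - x).

(* The term b * H (a / b) is meaningful: a / b lies in [0, 1], or the term has
   the form 0 * H (0 / 0), which is read as 0 (and is 0 here, as 0 * _ = 0).
   The test b == 0 is needed because a / 0 = 0 for every a. *)
Definition H_arg_ok (R : realType) (a b : R) : bool :=
  if b == 0 then a == 0 else 0 <= a / b <= 1.

Definition SCL_half (R : realType) (alpha : R) : R :=
  if alpha <= 2^-1 then 2^-1 + Num.sqrt (alpha * (1 - alpha)) else 1.

(* For 0 <= 2 mu <= 1 and 0 <= delta <= 1/2 - mu all the arguments of H in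
   E_exp are meaningful, so there is no domain condition for delta. *)
Definition E_exp (R : realType) (mu delta : R) : R :=
  (mu + delta) * H (mu / (mu + delta))
  + (1 - mu - delta) * H (mu / (1 - mu - delta))
  - H (2 * mu).

Definition G_exp (R : realType) (mu lambda : R) : R :=
  (1 - 2 * mu) * ln 2 + H (2 * mu)
  - (4 * mu - 1) * H (lambda / (4 * mu - 1))
  - (2 - 4 * mu) * H ((2 * mu - lambda) / (2 - 4 * mu))
  + lambda * ln (2 / pi).

Definition lambda_ok (R : realType) (mu lambda : R) : bool :=
  [&& 0 <= lambda <= 1,
      H_arg_ok lambda (4 * mu - 1)
    & H_arg_ok (2 * mu - lambda) (2 - 4 * mu)].

(* For 0 < mu < 1/4 the only lambda admitted by lambda_ok is 0, whereas
   lambda_star mu below is negative, so it cannot be the minimizer there. *)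
Definition is_G_minimizer (R : realType) (mu lambda : R) : Prop :=
  lambda_ok mu lambda /\
  forall l : R, lambda_ok mu l -> G_exp mu lambda <= G_exp mu l.

Definition A_coef (R : realType) (mu : R) : R :=
  2 / pi + (1 - 2 / pi) * (6 * mu - 1).

Definition lambda_star (R : realType) (mu : R) : R :=
  (A_coef mu
   - Num.sqrt (A_coef mu ^+ 2 - 8 * (1 - 2 / pi) * mu * (4 * mu - 1)))
  / (2 * (1 - 2 / pi)).

(* Main.v *)
(** For an n-subset T of the rows, the MDS property says that nonzero dual words
have weight larger than n, so that characters of weight at most n average to 0
over x. Replace the sign f_i = 2 * 1_{S_i} - 1 by a centered multiple h_i and let
W(x) be the multilinear extension, evaluated at the h_i, of the square of
Q = \sum_k binom(m, k)^{-1/2} e_k, where k runs over a window of bounded length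
L just below (mu + delta) m and e_k is the elementary symmetric polynomial.
Then W >= 0, and if the f_i were independent the W-average of \sum_i f_i would be
about 2 sqrt(alpha (1 - alpha)) m with alpha = mu + delta. The true averages
differ from the independent ones by a sum over nonzero dual words, which is at
most the largest coefficient of Q^2 of degree >= n (rate E) times
\sum_y \prod_i |hat f_i(y_i)|. The latter has rate G: averaging over the sets K
of 2n - m coordinates, one keeps the words meeting K in at least lambda m
places, bounds each factor in K by about 2/pi, and applies AM-GM and Parseval to
the two halves of the complement of K, each of which determines a dual word. For
mu < 1/4 this is void, and there E + G >= 0.

For the minimizer, G is strictly convex in lambda and its critical points are
the roots of a quadratic, of which the smaller one is admissible. *)
Require Import Defs.
From mathcomp Require Import all_boot all_order all_algebra.
From mathcomp Require Import boolp reals topology normedtype sequences derive.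
From mathcomp Require Import exp trigo complex ring lra zify.

Set Implicit Arguments.
Unset Strict Implicit.
Unset Printing Implicit Defensive.

Import Order.TTheory GRing.Theory Num.Theory.
Import Normc numFieldNormedType.Exports.

Local Open Scope ring_scope.

(** * The function x ln x and the minimizer of G *)

Section Entropy.
Variable R : realType.
Implicit Types a b x y mu l : R.

(** The estimate has to be uniform in [p], but [2 / pi] is only the limit of the character sum bound
    [2 / (p * sin (pi / p))]. Small odd primes are excluded by the densities: [2 * #|S i| - p] is
    odd, so a density within [eta] of one half forces [p] to be of order [1 / eta]. The prime 2
    escapes this argument and is excluded because no MDS matrix over F_2 has [2 <= n <= m - 2].
    Centering is forced since the sets have density only close to one half: with mean zero exactly,
    every nonempty product of the [h_i] averages to 0 under independence. Rescaling into [-1, 1]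
    keeps W an expectation of squares, over random signs with means [h_i]. The factor binom^{-1/2}
    gives each level of Q norm 1. Adjacent levels then correlate with strength about sqrt(alpha (1 -
    alpha)), and only one adjacent pair out of L is missing, so L depends on [eps] alone and costs a
    constant factor in the error. Testing W against the sign of one row disturbs one coordinate: the
    index set of a monomial and the support of a dual word then agree only off that index. Dual
    weight larger than n still leaves a monomial of degree at least n. *)

Definition xlnx x : R := x * ln x.

Lemma xlnx0 : xlnx 0 = 0. Proof. by rewrite /xlnx mul0r. Qed.

Lemma xlnx1 : xlnx 1 = 0. Proof. by rewrite /xlnx ln1 mulr0. Qed.

Lemma xlnxM a x : 0 < a -> 0 <= x -> xlnx (a * x) = x * xlnx a + a * xlnx x.
Proof.
move=> a0; rewrite le_eqVlt => /predU1P[<-|x0].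
  by rewrite mulr0 xlnx0 mul0r mulr0 addr0.
by rewrite /xlnx lnM ?posrE//; ring.
Qed.

Lemma ln_lt_sub1 x : 0 < x -> x != 1 -> ln x < x - 1.
Proof.
move=> x0 x1; have: ln x != 0 by rewrite ln_eq0.
by move=> /expR_gt1Dx; rewrite lnK ?posrE// => h; lra.
Qed.

Lemma ln_le_sub1 x : 0 < x -> ln x <= x - 1.
Proof.
move=> x0; case: (eqVneq x 1) => [->|x1]; first by rewrite ln1; lra.
exact/ltW/ln_lt_sub1.
Qed.

(** Strict convexity, reduced to [ln (y / x) < y / x - 1]. The endpoint [x = 0] is separate, since
    there [ln] has only a default value. *)
Lemma xlnx_tangent_lt x y : 0 <= x -> 0 < y -> x != y ->
  xlnx y + (1 + ln y) * (x - y) < xlnx x.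
Proof.
rewrite le_eqVlt => /predU1P[<-|x0] y0 xy.
  rewrite xlnx0 /xlnx; have -> : y * ln y + (1 + ln y) * (0 - y) = - y by ring.
  by rewrite oppr_lt0.
have h : ln (y / x) < y / x - 1.
  apply: ln_lt_sub1; first exact: divr_gt0.
  by apply: contra xy => /eqP e; rewrite -(divfK (lt0r_neq0 x0) y) e mul1r.
move: h; rewrite ln_div ?posrE// -(ltr_pM2l x0).
have -> : x * (y / x - 1) = y - x by field; exact: lt0r_neq0.
by rewrite /xlnx => h; lra.
Qed.

Lemma xlnx_tangent x y : 0 <= x -> 0 < y ->
  xlnx y + (1 + ln y) * (x - y) <= xlnx x.
Proof.
move=> x0 y0; case: (eqVneq x y) => [->|xy].
  by rewrite subrr mulr0 addr0.
exact/ltW/xlnx_tangent_lt.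
Qed.

(** Serves to replace rounded ratios by their limits. It is one-sided because the slope of [xlnx] is
    infinite at 0: for [x = 0] it holds because [xlnx y <= 0], and otherwise the constant depends on
    the fixed point [x] only. *)
Lemma xlnx_upper x y : 0 <= x -> 0 <= y <= 1 ->
  xlnx y <= xlnx x + (1 + `|ln x|) * `|y - x|.
Proof.
move=> x0 /andP[y0 y1].
have r0 : 0 <= (1 + `|ln x|) * `|y - x| by rewrite mulr_ge0// addr_ge0.
have yneg : xlnx y <= 0 by rewrite /xlnx mulr_ge0_le0// ln_le0.
move: x0; rewrite le_eqVlt => /predU1P[x00|x0].
  by rewrite -x00 xlnx0 in r0 *; lra.
move: y0; rewrite le_eqVlt => /predU1P[y00|y0].
  rewrite -y00 sub0r normrN (gtr0_norm x0) xlnx0 /xlnx.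
  by have := ler_norm (- ln x); rewrite normrN => h; nra.
have [yx|xy] := leP y x.
  rewrite (ler0_norm (x := y - x)) ?subr_le0//.
  have : ln y <= ln x by rewrite ler_ln ?posrE.
  have := ler_norm (- ln x); rewrite normrN /xlnx => h1 h2.
  have h3 : 0 <= (x - y) * (`|ln x| + ln x) by rewrite mulr_ge0//; lra.
  have h4 : 0 <= y * (ln x - ln y) by rewrite mulr_ge0//; lra.
  by lra.
rewrite (gtr0_norm (x := y - x)) ?subr_gt0//.
have h1 := ln_le0 y1.
have h2 : x * (ln y - ln x) <= y - x.
  rewrite -ln_div ?posrE//; have := ln_le_sub1 (divr_gt0 y0 x0).
  rewrite -(ler_pM2l x0).
  have -> // : x * (y / x - 1) = y - x by field; exact: lt0r_neq0.
by rewrite /xlnx; have := normr_ge0 (ln x); nra.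
Qed.

Lemma H_sum x : H x = - xlnx x - xlnx (1 - x).
Proof. by rewrite /H /xlnx; ring. Qed.

(** This is the exponential rate of the binomial coefficient of [b * m] over [a * m], freed of its
    divisions. *)
Lemma mulH a b : 0 <= a <= b -> b * H (a / b) = xlnx b - xlnx a - xlnx (b - a).
Proof.
move=> /andP[a0 ab].
have : 0 <= b by exact: le_trans ab.
rewrite le_eqVlt => /predU1P[b0|b0].
  have -> : a = 0 by lra.
  by rewrite -b0 subr0 xlnx0; ring.
have bn := lt0r_neq0 b0.
have e x : b * (x / b) = x by field.
have e2 : b * (1 - a / b) = b - a by field.
have h1 := xlnxM b0 (divr_ge0 a0 (ltW b0)).
have h2 : xlnx (b * (1 - a / b)) = (1 - a / b) * xlnx b + b * xlnx (1 - a / b).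
  by rewrite xlnxM// subr_ge0 ler_pdivrMr// mul1r.
rewrite e in h1; rewrite e2 in h2.
by rewrite H_sum h1 h2; ring.
Qed.

Lemma pi_gt2 : 2 < pi :> R.
Proof.
rewrite lt_neqAle pi_ge2 andbT; apply/eqP => e.
have := cos_pihalf R; rewrite -e divff ?pnatr_eq0// => c.
by have := cos1_gt0 R; rewrite c ltxx.
Qed.

Lemma pi_le4 : pi <= 4 :> R.
Proof. by have := pihalf_lt2 R; lra. Qed.

Lemma two_div_pi_bounds : 2^-1 <= 2 / (pi : R) < 1.
Proof.
have p0 := pi_gt0 R; rewrite ltr_pdivrMr// ler_pdivlMr//.
have := pi_gt2; have := pi_le4 => h1 h2; apply/andP; split; lra.
Qed.

Lemma H_arg_okE a b : 0 <= b -> H_arg_ok a b = (0 <= a <= b).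
Proof.
rewrite /H_arg_ok le_eqVlt => /predU1P[<-|b0]; first by rewrite eqxx -eq_le eq_sym.
by rewrite (gt_eqF b0) ler_pdivrMr// ler_pdivlMr// mul0r mul1r.
Qed.

Lemma lambda_okP mu l : 4^-1 <= mu -> 2 * mu <= 1 ->
  lambda_ok mu l <-> [/\ 0 <= l, l <= 4 * mu - 1 & 6 * mu - 2 <= l].
Proof.
move=> m1 m2; rewrite /lambda_ok !H_arg_okE; try lra.
split=> [/and3P[/andP[? ?] /andP[? ?] /andP[? ?]]|[? ? ?]]; first by split; lra.
by apply/and3P; split; apply/andP; split; lra.
Qed.

(* The first-order condition for a critical point of [G_exp mu] is
   [lambda_quad mu l = 0]. *)
Definition lambda_quad mu l : R :=
  (4 * mu - 1 - l) * (2 * mu - l) - 2 / pi * l * (2 - 6 * mu + l).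

Lemma G_expE mu l : 4^-1 <= mu -> 2 * mu <= 1 -> lambda_ok mu l ->
  G_exp mu l = (1 - 2 * mu) * ln 2 - xlnx (2 * mu) - xlnx (1 - 2 * mu)
    - (xlnx (4 * mu - 1) - xlnx l - xlnx (4 * mu - 1 - l))
    - (xlnx (2 - 4 * mu) - xlnx (2 * mu - l) - xlnx (2 - 6 * mu + l))
    + l * ln (2 / pi).
Proof.
move=> m1 m2 /lambda_okP -/(_ m1 m2) [l0 l1 l2].
rewrite /G_exp !mulH ?H_sum; [|apply/andP; split; lra..].
have -> : 2 - 4 * mu - (2 * mu - l) = 2 - 6 * mu + l by ring.
by ring.
Qed.

(** The four [xlnx] terms of [G_exp] containing [lambda] lie above their tangents at [l0]. The
    equation [lambda_quad mu l0 = 0], in logarithmic form, says that their slopes and [ln (2 / pi)]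
    cancel. Strictness comes from the term [xlnx l]. *)
Lemma G_exp_min_interior mu l0 l : 4^-1 <= mu -> 2 * mu <= 1 ->
  0 < l0 -> l0 < 4 * mu - 1 -> 6 * mu - 2 < l0 -> l0 < 2 * mu ->
  lambda_quad mu l0 = 0 -> lambda_ok mu l -> l != l0 ->
  G_exp mu l0 < G_exp mu l.
Proof.
move=> m1 m2 a0 a1 a2 a3 q0 okl ll0.
have okl0 : lambda_ok mu l0 by apply/lambda_okP => //; split; exact: ltW.
rewrite !G_expE//; move: okl => /lambda_okP -/(_ m1 m2) [b0 b1 b2].
have c0 : 0 < 2 / pi :> R by rewrite divr_gt0// pi_gt0.
have d1 : 0 < 4 * mu - 1 - l0 by lra.
have d2 : 0 < 2 * mu - l0 by lra.
have d3 : 0 < 2 - 6 * mu + l0 by lra.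
have e : ln (4 * mu - 1 - l0) + ln (2 * mu - l0)
       = ln (2 / pi) + ln l0 + ln (2 - 6 * mu + l0).
  have cl := mulr_gt0 c0 a0.
  rewrite -(lnM (x := 2 / pi)) ?posrE// -lnM ?posrE// -lnM ?posrE//; congr ln.
  by move: q0; rewrite /lambda_quad; lra.
have h0 := xlnx_tangent_lt b0 a0 ll0.
have h1 : xlnx (4 * mu - 1 - l0) + (1 + ln (4 * mu - 1 - l0)) *
    (4 * mu - 1 - l - (4 * mu - 1 - l0)) <= xlnx (4 * mu - 1 - l).
  by apply: xlnx_tangent => //; lra.
have h2 : xlnx (2 * mu - l0) + (1 + ln (2 * mu - l0)) *
    (2 * mu - l - (2 * mu - l0)) <= xlnx (2 * mu - l).
  by apply: xlnx_tangent => //; lra.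
have h3 : xlnx (2 - 6 * mu + l0) + (1 + ln (2 - 6 * mu + l0)) *
    (2 - 6 * mu + l - (2 - 6 * mu + l0)) <= xlnx (2 - 6 * mu + l).
  by apply: xlnx_tangent => //; lra.
have e' := congr1 ( *%R (l - l0)) e; rewrite /= in e'.
by lra.
Qed.

End Entropy.

Section Minimizer.
Variable R : realType.
Implicit Types a b x y mu l : R.
(** [lambda_quad] has leading coefficient [1 - 2 / pi > 0]. It is negative at [4 * mu - 1], which
    therefore lies between the roots, and positive at [0] and [6 * mu - 2], which lie to the left of
    that point and hence below the smaller root. *)
Lemma lambda_star_quad mu : 4^-1 < mu -> mu < 2^-1 ->
  [/\ 0 < lambda_star mu, lambda_star mu < 4 * mu - 1,
      6 * mu - 2 < lambda_star mu & lambda_quad mu (lambda_star mu) = 0].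
Proof.
move=> m1 m2; have /andP[c1 c2] := two_div_pi_bounds R.
rewrite /lambda_star /A_coef.
set c := 2 / pi in c1 c2 *; set A := c + _; set disc := A ^+ 2 - _.
have k0 : 0 < 1 - c by lra.
have sqE x : (2 * (1 - c) * x - A) ^+ 2 = disc + 4 * (1 - c) * lambda_quad mu x.
  by rewrite /lambda_quad -/c /disc /A; ring.
have q1 : lambda_quad mu (4 * mu - 1) < 0.
  rewrite /lambda_quad -/c subrr mul0r sub0r oppr_lt0.
  by apply: mulr_gt0; [apply: mulr_gt0|]; lra.
have q2 : 0 < lambda_quad mu (6 * mu - 2).
  have -> : lambda_quad mu (6 * mu - 2) = (1 - 2 * mu) * (2 - 4 * mu).
    by rewrite /lambda_quad; ring.
  by rewrite mulr_gt0//; lra.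
have q3 : 0 < lambda_quad mu 0.
  have -> : lambda_quad mu 0 = (4 * mu - 1) * (2 * mu) by rewrite /lambda_quad; ring.
  by rewrite mulr_gt0//; lra.
have disc0 : 0 < disc.
  have := sqr_ge0 (2 * (1 - c) * (4 * mu - 1) - A); rewrite sqE; nra.
have D0 : 0 < Num.sqrt disc by rewrite sqrtr_gt0.
have DE : Num.sqrt disc ^+ 2 = disc by rewrite sqr_sqrtr// ltW.
set D := Num.sqrt disc in D0 DE *.
set ls := (A - D) / _.
have lsE : 2 * (1 - c) * ls - A = - D by rewrite /ls; field; lra.
have lt1 : ls < 4 * mu - 1.
  have xE := sqE (4 * mu - 1); rewrite -DE in xE.
  rewrite ltNge; apply/negP => h.
  have h1 : 0 <= 2 * (1 - c) * (ls - (4 * mu - 1)) by rewrite !mulr_ge0//; lra.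
  have h2 : 0 < 4 * (1 - c) * - lambda_quad mu (4 * mu - 1) by rewrite !mulr_gt0//; lra.
  set u := 2 * (1 - c) * (4 * mu - 1) - A in xE.
  have h3 : u <= - D by rewrite /u; lra.
  have h4 : 0 <= (- u - D) * (- u + D) by rewrite mulr_ge0//; lra.
  by lra.
have upper x : 0 < lambda_quad mu x -> x < 4 * mu - 1 -> x < ls.
  move=> qx xm; have xE := sqE x; rewrite -DE in xE.
  have mE := sqE (4 * mu - 1); rewrite -DE in mE.
  rewrite ltNge; apply/negP => lsx.
  have g1 : 0 <= 2 * (1 - c) * (x - ls) by rewrite !mulr_ge0//; lra.
  have g2 : 0 <= 2 * (1 - c) * (4 * mu - 1 - x) by rewrite !mulr_ge0//; lra.
  have g3 : 0 < 4 * (1 - c) * - lambda_quad mu (4 * mu - 1) by rewrite !mulr_gt0//; lra.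
  have g4 : 0 < 4 * (1 - c) * lambda_quad mu x by rewrite !mulr_gt0//; lra.
  set u := 2 * (1 - c) * x - A in xE.
  set v := 2 * (1 - c) * (4 * mu - 1) - A in mE.
  have h1 : - D <= u by rewrite /u; lra.
  have h2 : u <= v by rewrite /u /v; lra.
  have h3 : v < D.
    rewrite ltNge; apply/negP => Dv.
    have : 0 <= (v - D) * (v + D) by rewrite mulr_ge0//; lra.
    by lra.
  have h4 : 0 <= (D - u) * (D + u) by rewrite mulr_ge0//; lra.
  by lra.
split=> //; [by apply: upper; lra|by apply: upper; lra|].
have lE := sqE ls; rewrite lsE sqrrN DE in lE.
have /eqP : 4 * (1 - c) * lambda_quad mu ls = 0 by lra.
by rewrite mulf_eq0 => /orP[/eqP|/eqP//]; lra.
Qed.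

(** At [mu = 0], [1/4] and [1/2] a single [lambda] is admissible and the closed formula is evaluated
    directly; for other [mu] the critical point is interior. *)
Lemma lambda_star_min mu l : mu = 0 \/ 4^-1 <= mu -> 0 <= 2 * mu <= 1 ->
  is_G_minimizer mu l <-> l = lambda_star mu.
Proof.
move=> m /andP[m0 m1]; have /andP[c1 c2] := two_div_pi_bounds R.
have single v : (forall l, lambda_ok mu l <-> l = v) -> lambda_star mu = v ->
    is_G_minimizer mu l <-> l = lambda_star mu.
  move=> okv ->; split; first by case=> /okv.
  by move=> ->; split=> [|l' /okv -> //]; exact/okv.
case: m => [mE|m2].
  apply: (single 0).
    move=> l'; rewrite mE; split=> [/and3P[/andP[l0 _]]|->].
      rewrite /H_arg_ok.
      case: ifP => [/eqP ?|_]; first by lra.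
      move=> /andP[+ _] _; rewrite mulr0 sub0r invrN1 mulrN1 oppr_ge0 => ?.
      by lra.
    by rewrite /lambda_ok /H_arg_ok !(mulr0, subr0, mul0r, lexx, ler01, eqxx) !if_same.
  (* At [mu = 0] the root is the absolute value of [4 / pi - 1]; its sign is where [pi <= 4]
     enters. *)
  rewrite /lambda_star /A_coef mE !mulr0 !mul0r subr0 sub0r sqrtr_sqr ger0_norm.
    by rewrite subrr mul0r.
  by lra.
have [mE|mE] := eqVneq mu 4^-1.
  apply: (single 0).
    by move=> l'; split=> [/lambda_okP -/(_ m2 m1) [? ? ?]|->]; [lra|apply/lambda_okP => //; split; lra].
  rewrite /lambda_star; have -> : 4 * mu - 1 = 0 by lra.
  rewrite mulr0 subr0 sqrtr_sqr ger0_norm ?subrr ?mul0r// /A_coef mE.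
  by lra.
have [mE'|mE'] := eqVneq mu 2^-1.
  apply: (single 1).
    by move=> l'; split=> [/lambda_okP -/(_ m2 m1) [? ? ?]|->]; [lra|apply/lambda_okP => //; split; lra].
  rewrite /lambda_star /A_coef mE'; set c := 2 / pi in c1 c2 *.
  have -> : (c + (1 - c) * (6 / 2 - 1)) ^+ 2 - 8 * (1 - c) / 2 * (4 / 2 - 1) = c ^+ 2.
    by field.
  by rewrite sqrtr_sqr ger0_norm; [field; lra|lra].
have m3 : 4^-1 < mu by rewrite lt_neqAle eq_sym mE.
have m4 : mu < 2^-1 by rewrite lt_neqAle mE'; lra.
have [s0 s1 s2 sq] := lambda_star_quad m3 m4.
have sok : lambda_ok mu (lambda_star mu) by apply/lambda_okP => //; split; exact: ltW.
have smin l' : lambda_ok mu l' -> l' != lambda_star mu ->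
    G_exp mu (lambda_star mu) < G_exp mu l'.
  by move=> okl'; apply: G_exp_min_interior => //; lra.
split=> [[okl lmin]|->].
  apply/eqP/negPn/negP => ne.
  by have := lt_le_trans (smin _ okl ne) (lmin _ sok); rewrite ltxx.
split=> // l' okl'; case: (eqVneq l' (lambda_star mu)) => [->//|ne].
exact/ltW/smin.
Qed.
End Minimizer.

(** * Words of linear codes and autocorrelations on the cube *)

Section Counting.
Variable I : finType.
Implicit Types A B K T : {set I}.

Lemma subset_card T k : (k <= #|T|)%N -> exists2 A : {set I}, A \subset T & #|A| = k.
Proof.
rewrite -bin_gt0 -cards_draws => /card_gt0P[A].
by rewrite inE => /andP[AT /eqP Ak]; exists A.
Qed.

(** It suffices to count the [K] having exactly [t] elements in a fixed [n]-subset [T0] of [T]; such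
    a [K] is recovered from its parts inside and outside [T0]. *)
Lemma card_draws_meet T n r t : (n <= #|T|)%N -> (t <= r)%N ->
  ('C(n, t) * 'C(#|I| - n, r - t)
    <= #|[set K : {set I} | (#|K| == r) && (t <= #|K :&: T|)]|)%N.
Proof.
move=> nT tr; have [T0 T0T T0n] := subset_card nT.
have cT0 : #|~: T0| = (#|I| - n)%N by rewrite cardsCs setCK T0n.
pose X := setX [set A : {set I} | A \subset T0 & #|A| == t]
               [set B : {set I} | B \subset ~: T0 & #|B| == (r - t)%N].
have <- : #|X| = ('C(n, t) * 'C(#|I| - n, r - t))%N.
  by rewrite cardsX !cards_draws cT0 T0n.
pose U (AB : {set I} * {set I}) := AB.1 :|: AB.2.
have Xp A B : (A, B) \in X -> [/\ A \subset T0, B \subset ~: T0, #|A| = t & #|B| = (r - t)%N].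
  by rewrite !inE /= => /andP[/andP[? /eqP ?] /andP[? /eqP ?]].
have Xl A B : (A, B) \in X -> (A :|: B) :&: T0 = A.
  move=> /Xp[s1 s2 _ _]; rewrite setIUl (setIidPl s1).
  by have := s2; rewrite -disjoints_subset -setI_eq0 => /eqP ->; rewrite setU0.
have Xr A B : (A, B) \in X -> (A :|: B) :&: ~: T0 = B.
  move=> /Xp[s1 s2 _ _]; rewrite setIUl (setIidPl s2).
  by have := s1; rewrite -[in X in X -> _](setCK T0) -disjoints_subset -setI_eq0 => /eqP ->; rewrite set0U.
have injU : {in X &, injective U}.
  move=> [A B] [A' B'] h h' e; rewrite /U /= in e.
  by congr (_, _); [rewrite -(Xl _ _ h) e Xl|rewrite -(Xr _ _ h) e Xr].
rewrite -(card_in_imset injU); apply/subset_leq_card/subsetP => K /imsetP[[A B] h ->].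
have [s1 s2 A1 B1] := Xp _ _ h.
rewrite inE /U /=; apply/andP; split.
  have d : [disjoint A & B].
    by rewrite disjoints_subset (subset_trans s1)// -setCS setCK.
  by rewrite cardsU (disjoint_setI0 d) cards0 subn0 A1 B1 subnKC.
rewrite -A1; apply: subset_leq_card; rewrite subsetI subsetUl.
exact: subset_trans T0T.
Qed.
End Counting.

(** * Sums of products over the words of a code of large minimum distance *)

Section MinDistance.
Variables (R : realFieldType) (F : finZmodType) (I : finType).
Implicit Types (y z : {ffun I -> F}) (K T : {set I}) (a : I -> F -> R).

Definition fsupp y : {set I} := [set i | y i != 0].

(** Restriction to [T] is injective on [D], so the left side is a part of the expansion of the
    product over [T] of the sums [\sum_k a i k ^+ 2]. *)
Lemma sum_prod_sqr_le (D : {set {ffun I -> F}}) T a :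
  (forall i k, 0 <= a i k) -> (forall i, \sum_k a i k ^+ 2 <= 2) ->
  {in D &, forall y z, {in T, y =1 z} -> y = z} ->
  \sum_(y in D) (\prod_(i in T) a i (y i)) ^+ 2 <= 2 ^+ #|T|.
Proof.
move=> a0 a2 injD.
pose rest y := [ffun i => if i \in T then y i else 0].
have restI : {in D &, injective rest}.
  move=> y z yD zD /ffunP e; apply: injD => // i iT.
  by have := e i; rewrite !ffunE iT.
pose G z := \prod_(i in T) a i (z i) ^+ 2.
have -> : \sum_(y in D) (\prod_(i in T) a i (y i)) ^+ 2 = \sum_(y in D) G (rest y).
  apply: eq_bigr => y _; rewrite /G -prodrXl; apply: eq_bigr => i iT.
  by rewrite ffunE iT.
rewrite -(big_imset G restI) /=.
have -> : 2 ^+ #|T| = \prod_(i in T) (2 : R) by rewrite prodr_const.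
apply: (@le_trans _ _ (\prod_(i in T) \sum_k a i k ^+ 2)); last first.
  apply: ler_prod.
  by move=> i _; rewrite a2 andbT sumr_ge0// => k _; exact: sqr_ge0.
rewrite (big_distr_big 0) /=.
rewrite [leRHS](bigID (mem (rest @: D))) /= -[leLHS]addr0 lerD//; last first.
  by apply: sumr_ge0 => z _; apply: prodr_ge0 => i _; exact: sqr_ge0.
rewrite le_eqVlt; apply/orP; left; apply/eqP/eq_bigl => z.
case: imsetP => [[y yD ->]|//]; rewrite ?andbF// andbT; apply/esym/pffun_onP; split=> //.
apply/supportP => i; rewrite ffunE; case: ifP => // _; by rewrite eqxx.
Qed.

Variables (n : nat) (D : {set {ffun I -> F}}).
Hypothesis subD : forall y z, y \in D -> z \in D -> y - z \in D.
Hypothesis distD : forall y, y \in D -> y != 0 -> (n < #|fsupp y|)%N.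

(** The difference of two words that agree on [T] lives on at most [n] coordinates. *)
Lemma mindist_inj T : (#|I| - n <= #|T|)%N ->
  {in D &, forall y z, {in T, y =1 z} -> y = z}.
Proof.
move=> cT y z yD zD yz; apply/eqP; rewrite -subr_eq0; apply/negPn/negP => ne.
have := distD (subD yD zD) ne; rewrite ltnNge => /negP; apply.
have : fsupp (y - z) \subset ~: T.
  apply/subsetP => i; rewrite !inE !ffunE; apply: contra => iT.
  by rewrite yz// subrr.
move=> /subset_leq_card; rewrite -(leq_add2l #|T|) cardsC => h.
by rewrite -(leq_add2l #|T|); apply: leq_trans h _; rewrite addnC -leq_subLR.
Qed.

Variables (a : I -> F -> R) (c : R).
Hypothesis a_ge0 : forall i k, 0 <= a i k.
Hypothesis a_sqr : forall i, \sum_k a i k ^+ 2 <= 2.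
Hypothesis a_c : forall i k, k != 0 -> a i k <= c.
Hypothesis a_0 : forall i, a i 0 <= 1.
Hypothesis c01 : 0 <= c <= 1.

(* Outside [K] there is room for two disjoint sets of [#|I| - n] coordinates;
   words of [D] are determined by either one, so AM-GM applies. *)
Lemma sum_prod_meet_le K t : (#|I| <= 2 * n)%N -> (n <= #|I|)%N ->
  #|K| = (2 * n - #|I|)%N ->
  \sum_(y in D | (t <= #|K :&: fsupp y|)%N) \prod_i a i (y i)
    <= c ^+ t * 2 ^+ (#|I| - n).
Proof.
move=> In nI cK; have /andP[c0 c1] := c01.
have cKC : #|~: K| = (2 * (#|I| - n))%N by rewrite cardsCs setCK cK; lia.
have [U UK cU] : exists2 U : {set I}, U \subset ~: K & #|U| = (#|I| - n)%N.
  by apply: subset_card; rewrite cKC; lia.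
pose V := ~: K :\: U.
have cV : #|V| = (#|I| - n)%N by rewrite cardsD (setIidPr UK) cKC cU; lia.
have split y : \prod_i a i (y i) =
    (\prod_(i in K) a i (y i)) * ((\prod_(i in U) a i (y i)) * \prod_(i in V) a i (y i)).
  rewrite (bigID (mem K)) /=; congr (_ * _).
  rewrite (bigID (mem U)) /=; congr (_ * _); apply: eq_bigl => i.
    have [iU|//] := boolP (i \in U); last by rewrite andbF.
    by have := subsetP UK _ iU; rewrite inE andbT.
  by rewrite !inE andbC.
(* Within [K] each nonzero coordinate contributes at most [c] and each zero one at most 1; at least
   [t] coordinates are nonzero. *)
have Kle y : (t <= #|K :&: fsupp y|)%N -> \prod_(i in K) a i (y i) <= c ^+ t.
  move=> ty; apply: le_trans (_ : c ^+ #|K :&: fsupp y| <= _); last exact: ler_wiXn2l.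
  rewrite -prodr_const (bigID (mem (fsupp y))) /= -[leRHS]mulr1.
  apply: ler_pM; [exact: prodr_ge0|exact: prodr_ge0| |].
    rewrite (eq_bigl (mem (K :&: fsupp y))) => [|i]; last by rewrite !inE.
    by apply: ler_prod => i; rewrite !inE a_ge0 /= => /andP[_ /a_c].
  apply: prodr_ile1 => i /andP[_]; rewrite !inE negbK a_ge0 => /eqP ->.
  exact: a_0.
have half T : #|T| = (#|I| - n)%N ->
    \sum_(y in D) (\prod_(i in T) a i (y i)) ^+ 2 <= 2 ^+ (#|I| - n).
  by move=> cT; rewrite -cT; apply: sum_prod_sqr_le => //; apply: mindist_inj; rewrite cT.
have step y : (t <= #|K :&: fsupp y|)%N -> \prod_i a i (y i) <=
    c ^+ t * (((\prod_(i in U) a i (y i)) ^+ 2 + (\prod_(i in V) a i (y i)) ^+ 2) / 2).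
  move=> ty; rewrite split.
  have u0 : 0 <= \prod_(i in U) a i (y i) by exact: prodr_ge0.
  have v0 : 0 <= \prod_(i in V) a i (y i) by exact: prodr_ge0.
  apply: ler_pM => //; [exact: prodr_ge0|exact: mulr_ge0|exact: Kle|].
  set u := \prod_(i in U) _; set v := \prod_(i in V) _.
  by have := sqr_ge0 (u - v); lra.
apply: (@le_trans _ _ (\sum_(y in D) c ^+ t *
    (((\prod_(i in U) a i (y i)) ^+ 2 + (\prod_(i in V) a i (y i)) ^+ 2) / 2))).
  rewrite big_mkcondr /=; apply: ler_sum => y yD; case: ifP => [|_]; first exact: step.
  by rewrite mulr_ge0 ?exprn_ge0// divr_ge0// addr_ge0// sqr_ge0.
rewrite -mulr_sumr -mulr_suml big_split /=; apply: ler_wpM2l; first exact: exprn_ge0.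
by have := half _ cU; have := half _ cV; lra.
Qed.

(** Double counting of pairs [(K, y)]: [sum_prod_meet_le] bounds the sum for each [K], while
    [card_draws_meet], applied to the support of [y], shows that each nonzero word occurs for at
    least the stated number of sets [K]. *)
Lemma sum_prod_mindist_le t : (#|I| <= 2 * n)%N -> (n <= #|I|)%N ->
  (t <= 2 * n - #|I|)%N ->
  (\sum_(y in D | y != 0) \prod_i a i (y i)) *
    ('C(n, t) * 'C(#|I| - n, 2 * n - #|I| - t))%:R
  <= c ^+ t * 2 ^+ (#|I| - n) * 'C(#|I|, 2 * n - #|I|)%:R.
Proof.
move=> In nI tn; set r := (2 * n - #|I|)%N; have /andP[c0 c1] := c01.
pose S := \sum_(K : {set I} | #|K| == r)
  \sum_(y in D | (t <= #|K :&: fsupp y|)%N) \prod_i a i (y i).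
apply: (@le_trans _ _ S); last first.
  apply: (@le_trans _ _ (\sum_(K : {set I} | #|K| == r) c ^+ t * 2 ^+ (#|I| - n))).
    by apply: ler_sum => K /eqP; apply: sum_prod_meet_le.
  rewrite sumr_const -[leLHS]mulr_natr -(card_draws I r) le_eqVlt; apply/orP; left.
  by apply/eqP; congr (_ * _%:R); apply: eq_card => K; rewrite !inE.
rewrite /S.
under [leRHS]eq_bigr => K _ do rewrite big_mkcondr /=.
rewrite exchange_big /= mulr_suml big_mkcondr /=; apply: ler_sum => y yD.
rewrite -big_mkcondr /= sumr_const.
have pr0 : 0 <= \prod_i a i (y i) by exact: prodr_ge0.
case: ifP => [y0|_]; last exact: mulrn_wge0.
rewrite -[leRHS]mulr_natr; apply: ler_wpM2l => //; rewrite ler_nat.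
have := card_draws_meet (ltnW (distD yD y0)) tn; rewrite -/r => h.
by apply: leq_trans h _; apply/eq_leq/eq_card => K; rewrite !inE.
Qed.
End MinDistance.

(** * Squares of multilinear polynomials on the cube *)

Section SymmetricDifference.
Variables (R : realFieldType) (I : finType).
Implicit Types (A B T : {set I}) (v : {set I} -> R) (h : I -> R).

Definition symd A B : {set I} := [set i | (i \in A) != (i \in B)].

Lemma symdK A : involutive (symd A).
Proof. by move=> B; apply/setP => i; rewrite !inE; do 2!case: (_ \in _). Qed.

Lemma card_symd A T : (#|A| + #|symd A T| = 2 * #|A :\: T| + #|T|)%N.
Proof.
have -> : symd A T = (A :\: T) :|: (T :\: A).
  by apply/setP => i; rewrite !inE; do 2!case: (_ \in _).
have -> : #|(A :\: T) :|: (T :\: A)| = (#|A :\: T| + #|T :\: A|)%N.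
  rewrite cardsU (_ : _ :&: _ = set0) ?cards0 ?subn0//.
  by apply/setP => i; rewrite !inE; do 2!case: (_ \in _).
have := cardsID T A; have := cardsID A T; rewrite [T :&: A]setIC; lia.
Qed.

(** On signs, monomials multiply by taking the symmetric difference of their index sets. Hence this
    is the coefficient of the monomial of [T] in the square of the polynomial with coefficients
    [v]. *)
Definition autocorr v T : R := \sum_A v A * v (symd A T).

Lemma autocorr_ge0 v T : (forall A, 0 <= v A) -> 0 <= autocorr v T.
Proof. by move=> v0; apply: sumr_ge0 => A _; exact: mulr_ge0. Qed.

(** An index in [T] contributes [1 + 1] to the product form of the sum, an index outside [1 + x]. *)
Lemma sum_exp_setD (x : R) T :
  \sum_(A : {set I}) x ^+ #|A :\: T| = 2 ^+ #|T| * (1 + x) ^+ (#|I| - #|T|).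
Proof.
transitivity (\prod_i ((if i \in T then 1 else x) + 1)).
  rewrite bigA_distr; apply: eq_big => [A|A _]; first by rewrite inE.
  rewrite -big_mkcond /= (bigID (mem T)) /= [X in X * _]big1 ?mul1r; last first.
    by move=> i /andP[_ ->].
  rewrite -prodr_const; apply: eq_big => [i|i]; first by rewrite !inE andbC.
  by rewrite !inE => /andP[/negbTE ->].
rewrite (bigID (mem T)) /=; congr (_ * _).
  by rewrite -prodr_const; apply: eq_bigr => i ->.
rewrite -cardsT -cardsDS ?subsetT// -prodr_const.
apply: eq_big => [i|i /negbTE ->]; last by rewrite addrC.
by rewrite !inE andbT.
Qed.

(** A Chernoff bound with tilt [y]: when [A] and [symd A T] both have at most [l] elements,
    [y ^+ (2 * l)] is at most [y] to the sum of their sizes, which equals [#|T| + 2 * #|A :\: T|];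
    summing over all [A] gives the product. *)
Lemma autocorr_le v T (l n : nat) (V y : R) : 0 < y <= 1 -> 0 <= V ->
  (forall A B, v A * v B <= V) -> (forall A, (l < #|A|)%N -> v A = 0) ->
  (n <= #|T|)%N ->
  y ^+ (2 * l) * autocorr v T <= V * ((2 * y) ^+ n * (1 + y ^+ 2) ^+ (#|I| - n)).
Proof.
move=> /andP[y0 y1] V0 vV v0 nT.
have y0' := ltW y0.
have step A : y ^+ (2 * l) * (v A * v (symd A T)) <= V * (y ^+ #|T| * (y ^+ 2) ^+ #|A :\: T|).
  have r0 : 0 <= V * (y ^+ #|T| * (y ^+ 2) ^+ #|A :\: T|) by rewrite !mulr_ge0 ?exprn_ge0.
  have [lA|lA] := ltnP l #|A|; first by rewrite v0// mul0r mulr0.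
  have [lB|lB] := ltnP l #|symd A T|; first by rewrite (v0 (symd A T))// !mulr0.
  rewrite mulrC; apply: le_trans (_ : V * y ^+ (2 * l) <= _).
    by apply: ler_wpM2r => //; exact: exprn_ge0.
  apply: ler_wpM2l => //; rewrite -exprM -exprD; apply: ler_wiXn2l => //.
  by have := card_symd A T; lia.
rewrite /autocorr mulr_sumr; apply: le_trans (ler_sum _ (fun A _ => step A)) _.
rewrite -mulr_sumr; apply: ler_wpM2l => //; rewrite -mulr_sumr sum_exp_setD.
have TI : (#|T| <= #|I|)%N by exact: max_card.
rewrite mulrA -exprMn [y * 2]mulrC.
have -> : (#|I| - n = (#|T| - n) + (#|I| - #|T|))%N by lia.
rewrite -{1}(subnKC nT) !exprD -!mulrA; apply: ler_wpM2l.
  by rewrite exprn_ge0// mulr_ge0.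
apply: ler_wpM2r; first by rewrite exprn_ge0// addr_ge0// sqr_ge0.
(* Since [2 * y <= 1 + y ^+ 2], a set larger than [n] only makes the bound smaller. *)
apply: lerXn2r; rewrite ?nnegrE ?mulr_ge0 ?addr_ge0 ?sqr_ge0//.
by have := sqr_ge0 (1 - y); lra.
Qed.

(** [P] is the law of independent signs with means [h i]. The sum is the expectation under [P] of
    the square of the polynomial with coefficients [v]. *)
Lemma quad_symd_ge0 v h : (forall i, -1 <= h i <= 1) ->
  0 <= \sum_(T : {set I}) autocorr v T * \prod_(i in T) h i.
Proof.
move=> h1.
pose s (b : bool) : R := if b then 1 else -1.
pose P (e : {ffun I -> bool}) := \prod_i ((1 + s (e i) * h i) / 2).
pose X A (e : {ffun I -> bool}) := \prod_(i in A) s (e i).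
have PX A B : \prod_(i in symd A B) h i = \sum_e P e * (X A e * X B e).
  transitivity (\prod_i \sum_(b : bool) (1 + s b * h i) / 2 *
      ((if i \in A then s b else 1) * (if i \in B then s b else 1))).
    rewrite [LHS]big_mkcond /=; apply: eq_bigr => i _; rewrite big_bool /s /= inE.
    by do 2!case: (i \in _) => /=; field.
  rewrite bigA_distr_bigA; apply: eq_bigr => e _.
  rewrite big_split /=; congr (_ * _); rewrite big_split /= /X.
  by congr (_ * _); rewrite [RHS]big_mkcond.
have -> : \sum_(T : {set I}) autocorr v T * \prod_(i in T) h i =
    \sum_e P e * (\sum_A v A * X A e) ^+ 2.
  transitivity (\sum_A \sum_T v A * v (symd A T) * \prod_(i in T) h i).
    by rewrite exchange_big /=; apply: eq_bigr => T _; rewrite mulr_suml.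
  transitivity (\sum_A \sum_B v A * v B * \sum_e P e * (X A e * X B e)).
    apply: eq_bigr => A _.
    rewrite (reindex_inj (inv_inj (symdK A))) /=; apply: eq_bigr => B _.
    by rewrite symdK PX.
  transitivity (\sum_A \sum_B \sum_e P e * ((v A * X A e) * (v B * X B e))).
    apply: eq_bigr => A _; apply: eq_bigr => B _; rewrite mulr_sumr.
    by apply: eq_bigr => e _; ring.
  under eq_bigr => A _ do rewrite exchange_big /=.
  rewrite exchange_big /=; apply: eq_bigr => e _.
  rewrite expr2 mulr_suml mulr_sumr; apply: eq_bigr => A _.
  by rewrite !mulr_sumr.
apply: sumr_ge0 => e _; apply: mulr_ge0; last exact: sqr_ge0.
apply: prodr_ge0 => i _; have /andP[? ?] := h1 i.
by rewrite divr_ge0// /s; case: (e i); lra.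
Qed.
End SymmetricDifference.

(** * Fourier analysis over F_p *)

Section Fourier.
Variables (R : realType) (p : nat).
Hypothesis p_pr : prime p.
Local Notation C := R[i].
Implicit Types (x t : R) (z w k : 'F_p) (f : 'F_p -> R).

Definition cis t : C := (cos t +i* sin t)%C.

Lemma cisD s t : cis (s + t) = cis s * cis t.
Proof. by rewrite /cis cosD sinD; simpc; congr (Complex _ _); ring. Qed.

Lemma cis0 : cis 0 = 1. Proof. by rewrite /cis cos0 sin0. Qed.

Lemma cisX t n : cis (t * n%:R) = cis t ^+ n.
Proof.
by elim: n => [|n IHn]; rewrite ?mulr0 ?cis0// exprS -IHn -cisD; congr cis; ring.
Qed.

Lemma normc_cis t : normc (cis t) = 1.
Proof. by rewrite /= cos2Dsin2 sqrtr1. Qed.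

Definition omega : C := cis (2 * pi / p%:R).

Let p0 : p%:R != 0 :> R. Proof. by rewrite pnatr_eq0 -lt0n prime_gt0. Qed.
Let pC0 : p%:R != 0 :> C. Proof. by rewrite pnatr_eq0 -lt0n prime_gt0. Qed.

Lemma omegaX : omega ^+ p = 1.
Proof.
rewrite /omega -cisX divfK// /cis mulr_natl.
by rewrite cos2pi sin2pi.
Qed.

Lemma omega_neq1 : omega != 1.
Proof.
have pp := pi_gt0 R; have p1 : 0 < p%:R :> R by rewrite ltr0n prime_gt0.
have p2 : 2 <= p%:R :> R by rewrite ler_nat prime_gt1.
have t0 : 0 < 2 * pi / p%:R :> R by rewrite divr_gt0 ?mulr_gt0.
have tpi : 2 * pi / p%:R <= pi :> R by rewrite ler_pdivrMr//; nra.
apply/eqP => /(congr1 (@complex.Re R)) /= e; have /eqP : 2 * pi / p%:R = 0 :> R.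
  by apply: cos_inj; rewrite ?cos0// in_itv /= ?lexx ?(ltW pp) ?(ltW t0) ?tpi.
by rewrite gt_eqF.
Qed.

Definition chi z : C := omega ^+ z.

Let Fp_mod (a : nat) : (a %% (Zp_trunc (pdiv p)).+2 = a %% p)%N.
Proof. by rewrite Fp_cast. Qed.

Lemma chiD z w : chi (z + w) = chi z * chi w.
Proof. by rewrite /chi /= Fp_mod expr_mod ?omegaX// exprD. Qed.

Lemma chiM z w : chi (z * w) = chi z ^+ w.
Proof. by rewrite /chi /= Fp_mod expr_mod ?omegaX// exprM. Qed.

Lemma chi0 : chi 0 = 1. Proof. by []. Qed.

Lemma normc_chi z : normc (chi z) = 1.
Proof.
rewrite /chi -[omega]/(cis _) -cisX; exact: normc_cis.
Qed.

Lemma chi_neq1 z : z != 0 -> chi z != 1.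
Proof.
move=> z0; apply: contra omega_neq1 => /eqP e.
have : chi (z * z^-1) = 1 by rewrite chiM e expr1n.
by rewrite divff// /chi /= modn_small ?Fp_cast ?prime_gt1// expr1 => ->.
Qed.

Lemma chi_conj z : (chi z)^*%C = chi (- z).
Proof.
have h : chi z * chi (- z) = 1 by rewrite -chiD subrr chi0.
have n0 : chi z != 0 by apply/eqP => e; move: h; rewrite e mul0r => /eqP; rewrite eq_sym oner_eq0.
apply: (mulfI n0); rewrite h; have := normc_chi z.
case: (chi z) => a b /= e; have : Num.sqrt (a ^+ 2 + b ^+ 2) ^+ 2 = 1 by rewrite e expr1n.
rewrite sqr_sqrtr ?addr_ge0 ?sqr_ge0// => e2.
by simpc; congr (Complex _ _); [rewrite -e2; ring|ring].
Qed.

(** Translating by [v0] multiplies the sum by [chi (g v0)], which is not 1. *)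
Lemma chi_sum0 (V : finZmodType) (g : V -> 'F_p) v0 :
  (forall u v, g (u + v) = g u + g v) -> g v0 != 0 -> \sum_v chi (g v) = 0.
Proof.
move=> gD g0; have /eqP : (1 - chi (g v0)) * \sum_v chi (g v) = 0.
  rewrite mulrBl mul1r [X in X - _](reindex_inj (addrI v0)) /= mulr_sumr -sumrB.
  by rewrite big1// => v _; rewrite gD chiD subrr.
by rewrite mulf_eq0 subr_eq0 eq_sym (negbTE (chi_neq1 g0)) => /eqP.
Qed.

Lemma chi_sum z : \sum_k chi (k * z) = if z == 0 then p%:R else 0.
Proof.
case: eqP => [->|/eqP z0].
  under eq_bigr => k _ do rewrite mulr0 chi0.
  by rewrite sumr_const card_Fp.
by apply: (@chi_sum0 _ (fun k => k * z) 1) => [u v|]; rewrite ?mulrDl ?mul1r.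
Qed.

Definition fhat f k : C := (\sum_z (f z)%:C%C * chi (- (k * z))) / p%:R.

Lemma fhat_inv f z : (f z)%:C%C = \sum_k fhat f k * chi (k * z).
Proof.
transitivity ((\sum_w (f w)%:C%C * \sum_k chi (k * (z - w))) / p%:R).
  rewrite (bigD1 z) //= subrr chi_sum eqxx big1 ?addr0 ?mulfK// => w wz.
  by rewrite chi_sum subr_eq0 eq_sym (negbTE wz) mulr0.
rewrite mulr_suml.
under eq_bigr => w _ do rewrite mulr_sumr mulr_suml.
rewrite exchange_big /=; apply: eq_bigr => k _.
rewrite /fhat mulrAC mulr_suml -mulr_suml mulr_suml mulr_suml.
by apply: eq_bigr => w _; rewrite mulrBr addrC chiD; ring.
Qed.

Lemma fhat_conj f k : (fhat f k)^*%C = (\sum_z (f z)%:C%C * chi (k * z)) / p%:R.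
Proof.
rewrite /fhat rmorphM rmorph_sum /= conjc_inv conjc_nat; congr (_ / _).
apply: eq_bigr => z _; rewrite rmorphM; congr (_ * _); first exact: conjc_real.
by rewrite [LHS]chi_conj opprK.
Qed.

Definition fabs f k : R := normc (fhat f k).

Lemma normc_sqr (z : C) : (normc z ^+ 2)%:C%C = z * z^*%C.
Proof.
case: z => a b /=; rewrite sqr_sqrtr ?addr_ge0 ?sqr_ge0//.
by simpc; congr (Complex _ _); ring.
Qed.

(** Parseval; the factor [1 / p] in [fhat] turns the right side into an average. *)
Lemma fabs_sqr_sum f : \sum_k fabs f k ^+ 2 = (\sum_z f z ^+ 2) / p%:R.
Proof.
apply: (@complexI R); rewrite rmorph_sum /= rmorphM rmorph_sum /= fmorphV rmorph_nat.
transitivity (\sum_k (\sum_z fhat f k * ((f z)%:C%C * chi (k * z))) / p%:R).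
  by apply: eq_bigr => k _; rewrite normc_sqr fhat_conj mulrA mulr_sumr.
rewrite -mulr_suml; congr (_ / _).
rewrite exchange_big /=; apply: eq_bigr => z _.
rewrite expr2 rmorphM /= [X in _ = _ * X]fhat_inv mulr_sumr.
by apply: eq_bigr => k _; ring.
Qed.

Lemma fabs_ge0 f k : 0 <= fabs f k.
Proof. by rewrite /fabs; case: (fhat f k) => a b; exact: sqrtr_ge0. Qed.

Lemma fhat0 f : fhat f 0 = ((\sum_z f z) / p%:R)%:C%C.
Proof.
rewrite /fhat rmorphM rmorph_sum /= fmorphV rmorph_nat; congr (_ / _).
by apply: eq_bigr => z _; rewrite mul0r oppr0 chi0 mulr1.
Qed.

End Fourier.

Section Norm.
Variable R : realType.
Local Notation C := R[i].

Lemma normc_real (x : R) : normc x%:C%C = `|x|.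
Proof. by rewrite /= expr0n /= addr0 sqrtr_sqr. Qed.

Lemma normc_prod (I : Type) (r : seq I) (P : pred I) (F : I -> C) :
  normc (\prod_(i <- r | P i) F i) = \prod_(i <- r | P i) normc (F i).
Proof. exact: (big_morph _ (@normcM R) (normc1 R)). Qed.

Lemma normc_sum_le (I : Type) (r : seq I) (P : pred I) (F : I -> C) :
  normc (\sum_(i <- r | P i) F i) <= \sum_(i <- r | P i) normc (F i).
Proof.
elim/big_ind2 : _ => [|x y z w xy zw|//]; first by rewrite normc0.
by apply: le_trans (le_normcD _ _) _; exact: lerD.
Qed.

(** The bound [- pi <= t] ensures later that [t + 2 * pi] lies to the right of [- (pi / 2)]. *)
Lemma cis_onto (a b : R) : a ^+ 2 + b ^+ 2 = 1 ->
  exists2 t, - pi <= t & cis t = (a +i* b)%C.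
Proof.
move=> ab; have a1 : -1 <= a <= 1.
  by apply/andP; split; have := sqr_ge0 b; nra.
have ac := acosK a1.
have sc : sin (acos a) = `|b| by rewrite sin_acos// -ab addrAC subrr add0r sqrtr_sqr.
have pp := pi_gt0 R.
have [b0|b0] := leP 0 b.
  exists (acos a); first by have := acos_ge0 a1; lra.
  by rewrite /cis sc ac ger0_norm.
exists (- acos a); first by rewrite lerN2 acos_lepi.
by rewrite /cis cosN sinN sc ac ltr0_norm// opprK.
Qed.
End Norm.

(** * Dual words of an MDS matrix and Poisson summation *)

Section Dual.
Variables (R : realType) (p : nat).
Hypothesis p_pr : prime p.
Variables (m n : nat) (B : 'M['F_p]_(m, n)).
Implicit Types (y z : {ffun 'I_m -> 'F_p}).
Local Notation C := R[i].

Definition dual_words : {set {ffun 'I_m -> 'F_p}} :=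
  [set y : {ffun 'I_m -> 'F_p} | \row_i y i *m B == 0].

Lemma dual_wordsB y z : y \in dual_words -> z \in dual_words -> y - z \in dual_words.
Proof.
rewrite !inE => /eqP yB /eqP zB; have -> : \row_i (y - z) i = \row_i y i - \row_i z i.
  by apply/rowP => i; rewrite !mxE !ffunE.
by rewrite mulmxBl yB zB subrr.
Qed.

(** A support of size at most [n] fits into an [n]-set [T]; the rows of [B] in [T] are independent,
    so the word vanishes on [T] too. *)
Lemma dual_words_dist : is_MDS B -> forall y, y \in dual_words -> y != 0 ->
  (n < #|fsupp y|)%N.
Proof.
move=> [nm freeB] y yD y0; rewrite ltnNge; apply/negP => supp_le.
have [T cT Tout] : exists2 T : {set 'I_m}, #|T| = n & forall i, i \notin T -> y i = 0.
  have [A A1 A2] : exists2 A : {set 'I_m},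
      A \subset ~: fsupp y & #|A| = (n - #|fsupp y|)%N.
    apply: subset_card; have := cardsC (fsupp y); rewrite card_ord => c.
    by rewrite leq_subLR c.
  exists (fsupp y :|: A) => [|i].
    rewrite cardsU (_ : _ :&: _ = set0) ?cards0 ?subn0 ?A2 ?subnKC//.
    by apply/eqP; rewrite setI_eq0 disjoint_sym disjoints_subset.
  by rewrite !inE negb_or negbK => /andP[/eqP].
move: yD freeB {supp_le nm}; rewrite inE; move: B.
(* Replacing [n] by [#|T|] lets [enum_val] serve as the injective row selection in [is_MDS]. *)
case: n / cT => B' /eqP yB freeB.
have fr := freeB (fun j => enum_val j) enum_val_inj.
have : \row_j y (enum_val j) *m rowsub (fun j : 'I_#|T| => enum_val j) B' = 0.
  rewrite -yB; apply/rowP => k; rewrite !mxE [RHS](bigID (mem T)) /=.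
  rewrite [X in _ = _ + X]big1 ?addr0 => [|i iT]; last by rewrite mxE Tout// mul0r.
  by rewrite [RHS]big_enum_val; apply: eq_bigr => j _; rewrite !mxE.
move/eqP; rewrite mulmx_free_eq0// => /eqP/rowP y_enum.
case/eqP: y0; apply/ffunP => i; rewrite ffunE.
have [iT|/Tout//] := boolP (i \in T).
by have := y_enum (enum_rank_in iT i); rewrite !mxE enum_rankK_in.
Qed.

(** Poisson summation: after Fourier inversion of each factor, the average over [x] of the character
    of [y B x] is 1 if [y B = 0] and 0 otherwise. *)
Lemma fourier_corr (f : 'I_m -> 'F_p -> R) :
  ((\sum_(x : 'cV['F_p]_n) \prod_i f i ((B *m x) i ord0)) / #|{: 'cV['F_p]_n}|%:R)%:C%C
  = \sum_(y in dual_words) \prod_i fhat (f i) (y i) :> C.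
Proof.
have N0 : #|{: 'cV['F_p]_n}|%:R != 0 :> C.
  by rewrite pnatr_eq0 -lt0n; apply/card_gt0P; exists 0.
rewrite rmorphM rmorph_sum /= fmorphV rmorph_nat.
pose yx y (x : 'cV['F_p]_n) := ((\row_i y i *m B) *m x) 0 0.
transitivity ((\sum_(y : {ffun 'I_m -> 'F_p}) (\prod_i fhat (f i) (y i)) * \sum_(x : 'cV['F_p]_n) chi R (yx y x))
               / #|{: 'cV['F_p]_n}|%:R).
  congr (_ / _).
  under [RHS]eq_bigr => y _ do rewrite mulr_sumr.
  rewrite [RHS]exchange_big /=; apply: eq_bigr => x _; rewrite rmorph_prod /=.
  under eq_bigr => i _ do rewrite (fhat_inv p_pr).
  rewrite bigA_distr_bigA; apply: eq_bigr => y _; rewrite big_split /=; congr (_ * _).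
  rewrite -(big_morph _ (chiD R p_pr) (chi0 R p)); congr chi.
  by rewrite /yx -mulmxA !mxE; apply: eq_bigr => i _; rewrite !mxE.
rewrite mulr_suml [RHS]big_mkcond /=; apply: eq_bigr => y _.
rewrite inE; case: eqP => [yB|/eqP yB].
  rewrite (_ : \sum_x _ = #|{: 'cV['F_p]_n}|%:R) ?mulfK//.
  rewrite -sumr_const; apply: eq_bigr => x _.
  by rewrite /yx yB mul0mx mxE chi0.
have [j yj] : exists j, (\row_i y i *m B) 0 j != 0.
  by move/eqP: yB => yB; apply/existsP; rewrite -negb_forall; apply/negP => /forallP h;
     apply: yB; apply/rowP => j; rewrite [RHS]mxE; apply/eqP.
rewrite (@chi_sum0 R _ p_pr _ _ (delta_mx j 0)) ?mulr0 ?mul0r// => [u v|].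
  by rewrite /yx mulmxDr mxE.
by rewrite /yx -colE mxE.
Qed.

Lemma corr_bound (f : 'I_m -> 'F_p -> R) :
  `|(\sum_(x : 'cV['F_p]_n) \prod_i f i ((B *m x) i ord0)) / #|{: 'cV['F_p]_n}|%:R
    - \prod_i ((\sum_z f i z) / p%:R)|
  <= \sum_(y in dual_words | y != 0) \prod_i fabs (f i) (y i).
Proof.
have d0 : 0 \in dual_words.
  by rewrite inE; apply/eqP; rewrite (_ : \row_i _ = 0) ?mul0mx//; apply/rowP => i; rewrite !mxE ffunE.
rewrite -normc_real; set u := _ / _; set v := \prod_i _.
have -> : (u - v)%:C%C = u%:C%C - v%:C%C by rewrite rmorphB.
have -> : v%:C%C = \prod_i fhat (f i) ((0 : {ffun 'I_m -> 'F_p}) i).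
  by rewrite /v rmorph_prod /=; apply: eq_bigr => i _; rewrite ffunE fhat0.
rewrite /u fourier_corr (bigD1 (0 : {ffun 'I_m -> 'F_p}))//= [X in normc X]addrAC subrr add0r.
apply: le_trans (normc_sum_le _ _ _) _.
by apply: ler_sum => y _; rewrite normc_prod.
Qed.
End Dual.

(** * Fourier coefficients of a sign function on F_p *)

Section CharacterSumBound.
Variables (R : realType) (p : nat).
Hypothesis p_pr : prime p.
Local Notation C := R[i].

(* The primitive of the positive part of [cos] on [-pi/2, 3pi/2]. *)
Let Phi (x : R) : R := if x <= pi / 2 then sin x else 1.

(** From [sin (x + d) - sin (x - d) = 2 * sin d * cos x] up to [pi / 2]; beyond that point the left
    side is 0 and [Phi (x + d)] is the maximum 1. *)
Let Phi_step (x d : R) : 0 <= d <= pi / 2 -> - (pi / 2) <= x -> x <= 3 * (pi / 2) ->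
  2 * sin d * Num.max 0 (cos x) <= Phi (x + d) - Phi (x - d).
Proof.
move=> /andP[d0 d1] x0 x1; have sd : 0 <= sin d by rewrite sin_ge0_pi; have := pi_ge0 R; lra.
have Phi_le1 t : Phi t <= 1 by rewrite /Phi; case: ifP => // _; exact: sin_le1.
have Phi_ge t : sin t <= Phi t by rewrite /Phi; case: ifP => // _; exact: sin_le1.
have [x2|x2] := leP x (pi / 2).
  have cx : 0 <= cos x by apply: cos_ge0_pihalf; rewrite x0.
  rewrite max_r//; have -> : Phi (x - d) = sin (x - d) by rewrite /Phi ifT//; lra.
  by have := Phi_ge (x + d); rewrite sinD sinB; lra.
have cx : cos x <= 0.
  have -> : x = (x - pi) + pi by ring.
  rewrite cosDpi oppr_le0; apply: cos_ge0_pihalf; apply/andP; split; lra.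
rewrite max_l// mulr0 subr_ge0; have -> : Phi (x + d) = 1 by rewrite /Phi ifF//; apply/negP; lra.
exact: Phi_le1.
Qed.

(** The [p] intervals of half-width [d = pi / p] are adjacent, so the bounds of [Phi_step]
    telescope; [Phi] ranges in [-1, 1], whence [2 * sin d] times the sum is at most 2. *)
Lemma sum_max_cos_le (t : R) : - (pi / 2) <= t < - (pi / 2) + 2 * pi / p%:R ->
  \sum_(0 <= j < p) Num.max 0 (cos (t + 2 * pi / p%:R * j%:R)) <= (sin (pi / p%:R))^-1.
Proof.
move=> /andP[t0 t1]; set d := pi / p%:R; have pp := pi_gt0 R.
have p0 : 0 < p%:R :> R by rewrite ltr0n prime_gt0.
have p2 : 2 <= p%:R :> R by rewrite ler_nat prime_gt1.
have d0 : 0 < d by rewrite divr_gt0.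
have dE : d * p%:R = pi by rewrite divfK ?gt_eqF.
have d1 : d <= pi / 2 by rewrite /d ler_pdivrMr// mulrAC ler_pdivlMr//; nra.
have hE : 2 * pi / p%:R = 2 * d by rewrite /d mulrA.
rewrite hE in t1 *.
have sd : 0 < sin d by rewrite sin_gt0_pi// d0; lra.
have tel N : (N <= p)%N -> 2 * sin d * \sum_(0 <= j < N) Num.max 0 (cos (t + 2 * d * j%:R))
    <= Phi (t + 2 * d * N%:R - d) - Phi (t - d).
  elim: N => [_|N IHN Np]; first by rewrite big_nil !mulr0 addr0 subrr.
  have {IHN} h := IHN (ltnW Np); rewrite big_nat_recr//= mulrDr.
  have Np' : N%:R + 1 <= p%:R :> R by rewrite natr1 ler_nat.
  have N0 : 0 <= N%:R :> R by [].
  have hs : 2 * sin d * Num.max 0 (cos (t + 2 * d * N%:R)) <=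
      Phi (t + 2 * d * N%:R + d) - Phi (t + 2 * d * N%:R - d).
    apply: Phi_step; [by rewrite (ltW d0)|nra|].
    have : d * (N%:R + 1) <= d * p%:R by rewrite ler_pM2l.
    by lra.
  have -> : t + 2 * d * N.+1%:R - d = t + 2 * d * N%:R + d by rewrite -natr1; ring.
  by lra.
have := tel p (leqnn p).
have Phi_le1 x : Phi x <= 1 by rewrite /Phi; case: ifP => // _; exact: sin_le1.
have Phi_geN1 x : -1 <= Phi x.
  by rewrite /Phi; case: ifP => _; [exact: sin_geN1|lra].
have := Phi_le1 (t + 2 * d * p%:R - d); have := Phi_geN1 (t - d).
move: (Phi _) (Phi _) => u v hu hv h.
by rewrite -[leRHS]mul1r ler_pdivlMr// mulrC; lra.
Qed.

(** A rotation makes the sum real and nonnegative. It is then a sum of cosines at equally spaced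
    angles, which only grows when extended to the positive parts over the whole of F_p. *)
Lemma normc_sum_chi_le (S : {set 'F_p}) :
  normc (\sum_(z in S) chi R z) <= (sin (pi / p%:R))^-1.
Proof.
set Z := \sum_(z in S) _; have pp := pi_gt0 R.
have p0 : 0 < p%:R :> R by rewrite ltr0n prime_gt0.
have [Z0|Z0] := eqVneq (normc Z) 0.
  rewrite Z0 invr_ge0; apply: sin_ge0_pi; apply/andP; split.
    by rewrite divr_ge0 ?ltW.
  rewrite ler_pdivrMr//; apply: ler_peMr; first exact: ltW.
  by rewrite ler1n prime_gt0.
have [t t_ge tZ] : exists2 t, - pi <= t & cis t * Z = (normc Z)%:C%C.
  have r0 : normc Z ^+ 2 != 0 by rewrite sqrf_eq0.
  case: Z Z0 r0 => a b /= Z0 r0; set r := Num.sqrt _ in Z0 r0 *.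
  have rE : r ^+ 2 = a ^+ 2 + b ^+ 2 by rewrite sqr_sqrtr// addr_ge0 ?sqr_ge0.
  have [|t t1 t2] := @cis_onto R (a / r) (- b / r).
    by rewrite !expr_div_n sqrrN -mulrDl -rE divff.
  exists t => //; rewrite t2; simpc; congr (Complex _ _); last by field.
  by apply: (mulIf Z0); rewrite -expr2 rE; field.
pose h : R := 2 * pi / p%:R; have h0 : 0 < h by rewrite divr_gt0 ?mulr_gt0.
(* [j] steps of length [h] bring the angle to within one step after [- (pi / 2)]; they are
   compensated by the translation [z + j%:R] of F_p. *)
pose q := (t + 2 * pi + pi / 2) / h.
have q0 : 0 <= q by rewrite divr_ge0 ?ltW//; lra.
pose j := Num.truncn q; pose s := t + 2 * pi - h * j%:R.
have /andP[j1 j2] := truncn_itv q0; rewrite -/j in j1 j2.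
have s_itv : - (pi / 2) <= s < - (pi / 2) + h.
  move: j1 j2; rewrite ler_pdivlMr// ltr_pdivrMr// -natr1 /s => j1 j2.
  by apply/andP; split; lra.
pose cv (w : 'F_p) : R := (w : nat)%:R.
have st z : cis t * chi R z = cis (s + h * cv (z + j%:R)).
  have -> : cis t = cis (s + h * j%:R) :> C.
    rewrite /s subrK cisD; have -> : cis (2 * pi) = 1 :> C.
      by rewrite mulr_natl /cis cos2pi sin2pi.
    by rewrite mulr1.
  have chE (w : 'F_p) : cis (h * cv w) = chi R w by rewrite cisX.
  rewrite !(cisD s) chE (chiD R p_pr) cisX -mulrA [chi R z * _]mulrC; congr (_ * (_ * _)).
  by rewrite /chi val_Fp_nat ?expr_mod// ?(omegaX R p_pr).
have -> : normc Z = \sum_(z in S) cos (s + h * cv (z + j%:R)).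
  have := congr1 (@complex.Re R) tZ; rewrite /= => <-.
  rewrite mulr_sumr (raddf_sum (@complex.Re R)) /=; apply: eq_bigr => z _.
  by rewrite st.
apply: le_trans (sum_max_cos_le s_itv).
have -> : \sum_(0 <= j0 < p) Num.max 0 (cos (s + 2 * pi / p%:R * j0%:R)) =
   \sum_(z : 'F_p) Num.max 0 (cos (s + h * cv (z + j%:R))).
  rewrite -(reindex_inj (addIr j%:R) (P := xpredT) (F := fun z : 'F_p => Num.max 0 (cos (s + h * cv z)))) /=.
  by rewrite -{1}(Fp_cast p_pr) big_mkord.
rewrite big_mkcond /=; apply: ler_sum => z _; case: ifP => _; rewrite le_max ?lexx ?orbT//.
Qed.

(** The sign is twice an indicator minus a constant, and constants have no coefficient at [k != 0].
    Multiplication by [- k] carries [S] to another set, so frequency 1 suffices. *)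
Lemma fabs_sign_le (S : {set 'F_p}) k : k != 0 ->
  fabs (fun z => if z \in S then 1 else -1 : R) k <= 2 / (p%:R * sin (pi / p%:R)).
Proof.
move=> k0; have p0 : 0 < p%:R :> R by rewrite ltr0n prime_gt0.
have injk : injective (fun z : 'F_p => - (k * z)).
  by move=> z w /oppr_inj /(mulfI k0).
rewrite /fabs /fhat.
have -> : \sum_z (if z \in S then 1 else -1 : R)%:C%C * chi R (- (k * z)) =
    (2 : C) * \sum_(z in (fun z : 'F_p => - (k * z)) @: S) chi R z.
  rewrite big_imset /=; last by move=> z w _ _ /injk.
  have e0 : \sum_z chi R (- (k * z)) = 0.
    apply: (@chi_sum0 R _ p_pr _ _ 1) => [u v|]; first by rewrite mulrDr opprD.
    by rewrite mulr1 oppr_eq0.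
  rewrite -[LHS]addr0 -[X in _ + X = _]e0 -big_split /= mulr_sumr [RHS]big_mkcond /=.
  apply: eq_bigr => z _; case: ifP => _; rewrite ?rmorphN rmorph1; ring.
rewrite normcM normcV !normcM.
have nn (l : nat) : normc (l%:R : C) = l%:R.
  by rewrite -(rmorph_nat (real_complex R)) normc_real ger0_norm.
rewrite !nn; have -> : 2 / (p%:R * sin (pi / p%:R)) = 2 * (sin (pi / p%:R))^-1 / p%:R :> R.
  by rewrite invfM; ring.
rewrite ler_wpM2r ?invr_ge0// ler_wpM2l//.
exact: normc_sum_chi_le.
Qed.
End CharacterSumBound.

(** * Averages against the weight *)

Section Mean.
Variables (R : realType) (p : nat).
Hypothesis p_pr : prime p.
Implicit Types (f g : 'F_p -> R) (S : {set 'F_p}).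

Definition mean f : R := (\sum_z f z) / p%:R.

Let p0 : 0 < p%:R :> R. Proof. by rewrite ltr0n prime_gt0. Qed.

Lemma mean_cst (x : R) : mean (fun=> x) = x.
Proof. by rewrite /mean sumr_const card_Fp// -[x *+ _]mulr_natr mulfK ?gt_eqF. Qed.

Lemma mean_le f g : (forall z, f z <= g z) -> mean f <= mean g.
Proof. by move=> fg; rewrite /mean ler_pM2r ?invr_gt0//; apply: ler_sum. Qed.

Lemma mean_affine f (a b : R) : mean (fun z => a * f z + b) = a * mean f + b.
Proof.
by rewrite /mean big_split /= mulrDl -mulr_sumr mulrA -/(mean _) mean_cst.
Qed.

Lemma fabs_sqr_sum_le1 f : (forall z, `|f z| <= 1) -> \sum_k fabs f k ^+ 2 <= 1.
Proof.
move=> f1; rewrite fabs_sqr_sum// -/(mean _) -[leRHS](mean_cst 1).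
by apply: mean_le => z; rewrite -real_normK ?num_real// expr_le1.
Qed.

Lemma fabs_le1 f k : (forall z, `|f z| <= 1) -> fabs f k <= 1.
Proof.
move=> /fabs_sqr_sum_le1; rewrite (bigD1 k) //= => h.
rewrite -(expr_le1 (n := 2))// ?fabs_ge0//; apply: le_trans h; rewrite lerDl.
by apply: sumr_ge0 => j _; exact: sqr_ge0.
Qed.

Lemma fabs0 f : fabs f 0 = `|mean f|.
Proof. by rewrite /fabs fhat0 normc_real. Qed.

Lemma fhat_affine f (a b : R) k : k != 0 ->
  fhat (fun z => a * f z + b) k = a%:C%C * fhat f k.
Proof.
move=> k0; have e0 : \sum_z chi R (- (k * z)) = 0.
  apply: (@chi_sum0 R _ p_pr _ _ 1) => [u v|]; first by rewrite mulrDr opprD.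
  by rewrite mulr1 oppr_eq0.
rewrite /fhat mulrA; congr (_ / _); rewrite mulr_sumr.
have e1 : b%:C%C * \sum_z chi R (- (k * z)) = 0 by rewrite e0 mulr0.
rewrite -[RHS]addr0 -[X in _ = _ + X]e1 mulr_sumr -big_split /=.
by apply: eq_bigr => z _; rewrite rmorphD rmorphM /=; ring.
Qed.

Lemma fabs_affine f (a b : R) k : k != 0 ->
  fabs (fun z => a * f z + b) k = `|a| * fabs f k.
Proof. by move=> k0; rewrite /fabs fhat_affine// normcM normc_real. Qed.

Lemma fabs_cst (x : R) (k : 'F_p) : k != 0 -> fabs (fun _ : 'F_p => x) k = 0.
Proof.
move=> k0; have := fabs_affine (fun _ : 'F_p => 0) 0 x k0; rewrite normr0 => e.
rewrite -[RHS](mul0r (fabs (fun _ : 'F_p => 0 : R) k)) -e; congr (normc (_ / _)).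
by apply: eq_bigr => z _; rewrite mul0r add0r.
Qed.

Definition sgn S z : R := if z \in S then 1 else -1.

Lemma normr_sgn S z : `|sgn S z| = 1.
Proof. by rewrite /sgn; case: ifP; rewrite ?normrN normr1. Qed.

Lemma sgn_sqr S z : sgn S z ^+ 2 = 1.
Proof. by rewrite /sgn; case: ifP; rewrite ?sqrrN expr1n. Qed.

Lemma mean_sgn S : mean (sgn S) = 2 * (#|S|%:R / p%:R - 2^-1).
Proof.
have -> : mean (sgn S) = mean (fun z => 2 * (if z \in S then 1 else 0) + -1).
  by congr (_ / _); apply: eq_bigr => z _; rewrite /sgn; case: ifP => _; lra.
rewrite mean_affine /mean -big_mkcond /= sumr_const; lra.
Qed.

(** The denominator brings the values back into [-1, 1], as needed for the positivity of the weight
    and for Parseval. *)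
Definition centered S z : R := (sgn S z - mean (sgn S)) / (1 + `|mean (sgn S)|).

Lemma centeredE S :
  centered S = fun z => (1 + `|mean (sgn S)|)^-1 * sgn S z
                        + - (mean (sgn S) / (1 + `|mean (sgn S)|)).
Proof. by apply/funext => z; rewrite /centered; ring. Qed.

Let den S : 0 < 1 + `|mean (sgn S)|.
Proof. by rewrite ltr_pwDl. Qed.

Lemma mean_centered S : mean (centered S) = 0.
Proof. by rewrite centeredE mean_affine mulrC subrr. Qed.

Lemma normr_centered_le S z : `|centered S z| <= 1.
Proof.
rewrite /centered normrM normfV (ger0_norm (ltW (den S))) ler_pdivrMr// mul1r.
by rewrite -(normr_sgn S z); exact: ler_normB.
Qed.

(** With [M] the mean of the sign, the left side is [(1 - M ^+ 2) / (1 + |M|)]. *)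
Lemma mean_centered_sgn S : mean (fun z => centered S z * sgn S z) = 1 - `|mean (sgn S)|.
Proof.
have -> : (fun z => centered S z * sgn S z) =
  (fun z => - (mean (sgn S) / (1 + `|mean (sgn S)|)) * sgn S z + (1 + `|mean (sgn S)|)^-1).
  by apply/funext => z; rewrite centeredE mulrDl -mulrA -expr2 sgn_sqr mulr1 addrC.
rewrite mean_affine; have := lt0r_neq0 (den S).
have : mean (sgn S) * mean (sgn S) = `|mean (sgn S)| * `|mean (sgn S)|.
  by rewrite -!expr2 real_normK ?num_real.
move: (mean _) => x; move: `|x| => y e n0.
have -> : - (x / (1 + y)) * x = - (x * x) / (1 + y) by ring.
by rewrite e; field.
Qed.

Lemma fabs_centered_le S k : k != 0 -> fabs (centered S) k <= fabs (sgn S) k.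
Proof.
move=> k0; rewrite centeredE fabs_affine// ger0_norm ?invr_ge0 ?(ltW (den S))//.
rewrite ler_piMl ?fabs_ge0// invf_le1 ?den//.
by rewrite lerDl.
Qed.
End Mean.

(** * Averages against the weight, compared with independent coordinates *)

Section WeightedAverage.
Variables (R : realType) (p : nat).
Hypothesis p_pr : prime p.
Variables (m n : nat) (B : 'M['F_p]_(m, n)) (S : 'I_m -> {set 'F_p}).
Hypothesis mdsB : is_MDS B.
Variables (v : {set 'I_m} -> R) (P c : R) (t : nat).
Hypothesis m2n : (m <= 2 * n)%N.
Hypothesis t2n : (t <= 2 * n - m)%N.
Hypothesis v_ge0 : forall A, 0 <= v A.
Hypothesis autocorr_P : forall T : {set 'I_m}, (n <= #|T|)%N -> autocorr v T <= P.
Hypothesis c01 : 0 < c <= 1.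
Hypothesis c_sgn : forall i k, k != 0 -> fabs (sgn R (S i)) k <= c.
Hypothesis t_bin : (0 < 'C(n, t) * 'C(m - n, 2 * n - m - t))%N.
Implicit Types (y : {ffun 'I_m -> 'F_p}) (T : {set 'I_m}) (g : 'F_p -> R).

Local Notation h i := (centered R (S i)).

Definition avg (F : 'cV['F_p]_n -> R) : R := (\sum_x F x) / #|{: 'cV['F_p]_n}|%:R.

Definition weight (x : 'cV['F_p]_n) : R :=
  \sum_(T : {set 'I_m}) autocorr v T * \prod_(i in T) h i ((B *m x) i ord0).

Definition dual_bound : R :=
  c ^+ t * 2 ^+ (m - n) * 'C(m, 2 * n - m)%:R
    / ('C(n, t) * 'C(m - n, 2 * n - m - t))%:R.

(** Makes a monomial of the weight times the test function [g] at row [i0] a product over all rows,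
    the form required by [corr_bound]. *)
Let factor i0 g T j : 'F_p -> R := fun z =>
  (if j \in T then h j z else 1) * (if j == i0 then g z else 1).

(** One family for all [T] at once. The value 1 at frequency 0 covers rows outside [T], and the
    maximum covers both cases at [i0]. There the extra [c] makes nonzero frequencies at most [c] as
    for the other rows; it is paid for by [c^-1] in [prod_factor_le]. In either case the squares sum
    to at most 2. *)
Let majorant i0 g j (k : 'F_p) : R :=
  if j == i0 then c * Num.max (fabs g k) (fabs (fun z => h j z * g z) k)
  else if k == 0 then 1 else fabs (h j) k.

Let majorant_ge0 i0 g j k : 0 <= majorant i0 g j k.
Proof.
have /andP[c0 _] := c01.
rewrite /majorant; case: ifP => _; first by rewrite mulr_ge0 ?(ltW c0)// le_max fabs_ge0.
by case: ifP => // _; exact: fabs_ge0.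
Qed.

Let normr_hg g j z : (forall z, `|g z| <= 1) -> `|h j z * g z| <= 1.
Proof. by move=> g1; rewrite normrM mulr_ile1// normr_centered_le. Qed.

Lemma sum_majorant_le i0 g : (forall z, `|g z| <= 1) ->
  \sum_(y in dual_words B | y != 0) \prod_j majorant i0 g j (y j) <= dual_bound.
Proof.
move=> g1; have /andP[c0 c1] := c01; have nm := mdsB.1.
rewrite /dual_bound ler_pdivlMr ?ltr0n//.
have := @sum_prod_mindist_le R _ _ n (dual_words B) (@dual_wordsB _ _ _ B)
  (dual_words_dist mdsB) (majorant i0 g) c (@majorant_ge0 i0 g).
rewrite card_ord; apply => //.
- move=> j; rewrite /majorant; case: eqP => _.
    apply: (@le_trans _ _ (\sum_k (fabs g k ^+ 2 + fabs (fun z => h j z * g z) k ^+ 2))).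
      apply: ler_sum => k _; rewrite exprMn.
      apply: (@le_trans _ _ (Num.max (fabs g k) (fabs (fun z => h j z * g z) k) ^+ 2)).
        by rewrite ler_piMl ?sqr_ge0// expr_le1// (ltW c0).
      by rewrite /Num.max; case: ifP => _; rewrite ?lerDl ?lerDr sqr_ge0.
    rewrite big_split /=; have := fabs_sqr_sum_le1 p_pr g1.
    have := fabs_sqr_sum_le1 p_pr (fun z => normr_hg j z g1).
    lra.
  apply: (@le_trans _ _ (\sum_k ((if k == 0 then 1 else 0) + fabs (h j) k ^+ 2))).
    apply: ler_sum => k _; case: eqP => _; rewrite ?expr1n ?add0r// lerDl.
    exact: sqr_ge0.
  rewrite big_split /= -big_mkcond /= big_pred1_eq.
  have := fabs_sqr_sum_le1 p_pr (normr_centered_le R (S j)).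
  lra.
- move=> j k k0; rewrite /majorant (negbTE k0); case: ifP => _.
    rewrite ler_piMr ?(ltW c0)// ge_max !fabs_le1// => z; exact: normr_hg.
  by apply: le_trans (c_sgn _ k0); exact: fabs_centered_le.
- move=> j; rewrite /majorant eqxx; case: ifP => // _.
  rewrite mulr_ile1// ?(ltW c0) ?le_max ?fabs_ge0// ge_max !fabs_le1// => z.
  exact: normr_hg.
by rewrite (ltW c0).
Qed.

(** Off [i0], a row in [T] carries a mean-zero function and a row outside [T] a constant, so a
    nonzero product forces [T] and the support of [y] to agree there. *)
Lemma prod_factor_le i0 g T y :
  \prod_j fabs (factor i0 g T j) (y j) <=
  (if T :\ i0 == fsupp y :\ i0 then c^-1 * \prod_j majorant i0 g j (y j) else 0).
Proof.
have /andP[c0 _] := c01.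
have facE j : j != i0 -> factor i0 g T j = fun z => if j \in T then h j z else 1.
  by move=> ji; apply/funext => z; rewrite /factor (negbTE ji) mulr1.
case: eqP => [/setP eT|/eqP neT].
  rewrite (bigD1 i0)//= [X in _ <= _ * X](bigD1 i0)//= mulrA.
  apply: ler_pM; [exact: fabs_ge0|by apply: prodr_ge0 => j _; exact: fabs_ge0| |].
    rewrite /majorant eqxx mulrA mulVf ?gt_eqF// mul1r le_max /factor.
    case: (i0 \in T); apply/orP; [right|left]; rewrite le_eqVlt; apply/orP; left;
      apply/eqP; congr fabs; apply/funext => z; rewrite eqxx ?mul1r//.
  apply: ler_prod => j ji; rewrite fabs_ge0 facE// /majorant (negbTE ji).
  have := eT j; rewrite !inE ji /= => ->.
  by case: eqP => [->|//]; rewrite fabs0 mean_cst// normr1.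
have [j] : exists j, (j \in T :\ i0) != (j \in fsupp y :\ i0).
  apply/existsP; rewrite -negb_forall; apply: contra neT => /forallP h'.
  by apply/eqP/setP => j; apply/eqP.
rewrite !inE; have [->|ji] := eqVneq j i0; rewrite ?eqxx//= => ej.
rewrite (bigD1 j)//= (_ : fabs _ _ = 0) ?mul0r// facE//.
have [jT|jT] := boolP (j \in T).
  have -> : y j = 0 by apply/eqP; move: ej; rewrite jT; case: (y j == 0).
  by rewrite fabs0 mean_centered// normr0.
apply: fabs_cst => //; apply/negP => y0.
by move: ej; rewrite (negbTE jT) y0.
Qed.

(** At most two sets agree with [U] off [i0], and both have at least [n] elements: the strict
    inequality [n < #|U|] pays for the removal of [i0]. *)
Lemma sum_autocorr_fiber_le i0 (U : {set 'I_m}) : (n < #|U|)%N ->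
  \sum_(T : {set 'I_m} | T :\ i0 == U :\ i0) autocorr v T <= 2 * P.
Proof.
move=> nU; have P0 : 0 <= P.
  by apply: le_trans (autocorr_P (ltnW nU)); exact: autocorr_ge0.
apply: (@le_trans _ _ (\sum_(T : {set 'I_m} | T :\ i0 == U :\ i0) P)).
  apply: ler_sum => T /eqP TU; apply: autocorr_P.
  rewrite -ltnS; apply: leq_trans nU _; rewrite (cardsD1 i0 U) -TU.
  apply: leq_trans (leq_add (leq_b1 _) (leqnn _)) _; rewrite add1n ltnS.
  by apply: subset_leq_card; exact: subD1set.
rewrite sumr_const -[leLHS]mulr_natr mulrC ler_wpM2r// ler_nat.
apply: (@leq_trans #|[set U :\ i0; i0 |: U]|); last by rewrite cards2; case: (_ != _).
apply: subset_leq_card; apply/subsetP => T TU'.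
have TU : T :\ i0 = U :\ i0 by apply/eqP.
rewrite in_set2.
have [iT|iT] := boolP (i0 \in T); last first.
  by rewrite -TU; apply/orP; left; apply/eqP/setP => j; rewrite !inE;
     case: eqP => // ->; exact: negbTE.
apply/orP; right; apply/eqP/setP => j; have /setP/(_ j) := TU; rewrite !inE.
by case: eqP => // ->.
Qed.

(** Because each [h j] has mean zero, independent coordinates leave only the terms [set0] and
    [[set i0]]. The remainder is a sum over nonzero dual words, grouped by the sets [T] that each
    word allows. *)
Lemma weight_avg_approx i0 g : (forall z, `|g z| <= 1) ->
  `|avg (fun x => weight x * g ((B *m x) i0 ord0))
    - (autocorr v set0 * mean g
       + autocorr v [set i0] * mean (fun z => h i0 z * g z))|
  <= 2 * P * dual_bound / c.
Proof.
move=> g1; have /andP[c0 _] := c01.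
pose Mn T := \prod_j mean (factor i0 g T j).
pose Av T := avg (fun x => \prod_j factor i0 g T j ((B *m x) j ord0)).
have AvE : avg (fun x => weight x * g ((B *m x) i0 ord0)) = \sum_T autocorr v T * Av T.
  rewrite /avg; under [RHS]eq_bigr => T _ do rewrite mulrA mulr_sumr.
  rewrite -mulr_suml exchange_big /=; congr (_ / _); apply: eq_bigr => x _.
  rewrite /weight mulr_suml; apply: eq_bigr => T _; rewrite -mulrA; congr (_ * _).
  rewrite /factor [RHS]big_split /=; congr (_ * _); first by rewrite big_mkcond.
  by rewrite -big_mkcond big_pred1_eq.
have MnE : autocorr v set0 * mean g + autocorr v [set i0] * mean (fun z => h i0 z * g z)
    = \sum_T autocorr v T * Mn T.
  have s0 : set0 != [set i0] :> {set 'I_m} by apply/eqP => /setP /(_ i0); rewrite !inE eqxx.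
  rewrite (bigD1 set0)//= (bigD1 [set i0]) 1?eq_sym//= [X in _ + (_ + X)]big1 ?addr0.
    congr (_ * _ + _ * _); rewrite /Mn (bigD1 i0)//= big1 ?mulr1 => [|j ji].
    - by congr mean; apply/funext => z; rewrite /factor inE eqxx mul1r.
    - rewrite -[RHS](mean_cst p_pr 1); congr mean.
      by apply/funext => z; rewrite /factor inE (negbTE ji) mulr1.
    - by congr mean; apply/funext => z; rewrite /factor inE eqxx.
    - rewrite -[RHS](mean_cst p_pr 1); congr mean.
      by apply/funext => z; rewrite /factor inE (negbTE ji) mulr1.
  move=> T /andP[T0 Ti]; have : ~~ (T \subset [set i0]) by rewrite subset1 negb_or Ti.
  move=> /subsetPn[j jT]; rewrite inE => ji.
  rewrite /Mn (bigD1 j)//= (_ : mean _ = 0) ?mul0r ?mulr0//.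
  rewrite -[RHS](mean_centered R p_pr (S j)); congr mean; apply/funext => z.
  by rewrite /factor jT (negbTE ji) mulr1.
rewrite AvE MnE -sumrB; apply: le_trans (ler_norm_sum _ _ _) _.
apply: (@le_trans _ _ (\sum_T autocorr v T * \sum_(y in dual_words B | y != 0)
   (if T :\ i0 == fsupp y :\ i0 then c^-1 * \prod_j majorant i0 g j (y j) else 0))).
  apply: ler_sum => T _; rewrite -mulrBr normrM ger0_norm ?autocorr_ge0//.
  apply: ler_wpM2l; first exact: autocorr_ge0.
  apply: le_trans (corr_bound p_pr B (factor i0 g T)) _.
  by apply: ler_sum => y _; exact: prod_factor_le.
under eq_bigr => T _ do rewrite mulr_sumr.
rewrite exchange_big /=.
apply: (@le_trans _ _ (\sum_(y in dual_words B | y != 0)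
   (2 * P) * (c^-1 * \prod_j majorant i0 g j (y j)))); last first.
  have P0 : 0 <= P.
    have := autocorr_P (T := setT); rewrite cardsT card_ord => /(_ mdsB.1).
    by apply: le_trans; exact: autocorr_ge0.
  rewrite -mulr_sumr -mulr_sumr.
  have -> : 2 * P * dual_bound / c = 2 * P * (c^-1 * dual_bound) by ring.
  rewrite ler_wpM2l ?mulr_ge0// ler_wpM2l ?invr_ge0 ?(ltW c0)//.
  exact: sum_majorant_le.
apply: ler_sum => y /andP[yD y0].
rewrite [leLHS](_ : _ = (\sum_(T : {set 'I_m} | T :\ i0 == fsupp y :\ i0) autocorr v T) *
   (c^-1 * \prod_j majorant i0 g j (y j))); last first.
  rewrite mulr_suml [RHS]big_mkcond /=; apply: eq_bigr => T _.
  by case: ifP => _; rewrite ?mulr0.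
apply: ler_wpM2r; last exact: sum_autocorr_fiber_le (dual_words_dist mdsB yD y0).
by rewrite mulr_ge0 ?invr_ge0 ?(ltW c0)// prodr_ge0.
Qed.

Lemma weight_ge0 x : 0 <= weight x.
Proof.
apply: quad_symd_ge0 => i; rewrite -ler_norml; exact: normr_centered_le.
Qed.

(* Testing [weight] against [1] and against each [sgn R (S i)]. *)
Lemma weight_avg_ineq (b theta q : R) : (0 < m)%N ->
  (forall i, `|mean (sgn R (S i))| <= b) ->
  (forall i, q <= autocorr v [set i]) -> 0 <= q -> b <= 1 ->
  (forall x : 'cV['F_p]_n, \sum_i sgn R (S i) ((B *m x) i ord0) <= theta * m%:R) ->
  q * (1 - b) <= (theta + b) * autocorr v set0
                 + (1 + `|theta|) * (2 * P * dual_bound / c).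
Proof.
move=> m0 hb hq q0 b1 hx; set err := 2 * P * dual_bound / c.
have mR : 0 < m%:R :> R by rewrite ltr0n.
have p00 : 0 <= autocorr v set0 by exact: autocorr_ge0.
have W1 : `|avg weight - autocorr v set0| <= err.
  have := @weight_avg_approx (Ordinal m0) (fun=> 1); rewrite mean_cst// mulr1.
  have -> : mean (fun z => h (Ordinal m0) z * 1) = 0.
    rewrite -[RHS](mean_centered R p_pr (S (Ordinal m0))); congr mean.
    by apply/funext => z; rewrite mulr1.
  have -> : avg (fun x => weight x * 1) = avg weight.
    by congr (_ / _); apply: eq_bigr => x _; rewrite mulr1.
  by rewrite mulr0 addr0; apply => z; rewrite normr1.
have Wi i : q * (1 - b) - b * autocorr v set0 - err <=
    avg (fun x => weight x * sgn R (S i) ((B *m x) i ord0)).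
  have sg1 z : `|sgn R (S i) z| <= 1 by rewrite normr_sgn.
  have := weight_avg_approx i sg1; rewrite mean_centered_sgn// -/err ler_distl => /andP[h1 _].
  have hbi := hb i; have := hq i; have := ler_norm (- mean (sgn R (S i))); rewrite normrN.
  set a1 := autocorr v [set i] in h1 *; set a0 := autocorr v set0 in p00 h1 *.
  move: h1 hbi; set M := mean _; set N := `|M| => h1 hbi h2 h3.
  have k1 : 0 <= (a1 - q) * (1 - N) by rewrite mulr_ge0//; lra.
  have k2 : 0 <= q * (b - N) by rewrite mulr_ge0//; lra.
  have k3 : 0 <= a0 * (b + M) by rewrite mulr_ge0//; lra.
  by lra.
have avgF : avg (fun x => weight x * \sum_i sgn R (S i) ((B *m x) i ord0)) =
    \sum_i avg (fun x => weight x * sgn R (S i) ((B *m x) i ord0)).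
  rewrite /avg -mulr_suml; congr (_ / _); rewrite exchange_big /=.
  by apply: eq_bigr => x _; rewrite mulr_sumr.
(* Positivity of the weight turns the pointwise bound by [theta] into a bound for the average. *)
have up : avg (fun x => weight x * \sum_i sgn R (S i) ((B *m x) i ord0)) <=
    theta * m%:R * avg weight.
  rewrite /avg mulrA ler_pM2r ?invr_gt0 ?ltr0n; last by apply/card_gt0P; exists 0.
  rewrite mulr_sumr; apply: ler_sum => x _; rewrite mulrC ler_wpM2r//.
  exact: weight_ge0.
have lo : (q * (1 - b) - b * autocorr v set0 - err) * m%:R <=
    avg (fun x => weight x * \sum_i sgn R (S i) ((B *m x) i ord0)).
  rewrite avgF mulr_natr -[m in _ *+ m]card_ord -sumr_const.
  by apply: ler_sum => i _; exact: Wi.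
have {up lo} := le_trans lo up; rewrite -mulrA [m%:R * _]mulrC mulrA ler_pM2r// => key.
(* [theta] may be negative, hence the absolute value. *)
have tW : theta * avg weight <= theta * autocorr v set0 + `|theta| * err.
  rewrite -lerBlDl -mulrBr; apply: le_trans (ler_norm _) _.
  by rewrite normrM ler_wpM2l.
by lra.
Qed.
End WeightedAverage.

(** * Boundary cases *)

Section SmallRate.
Variable R : realType.
Implicit Types a b x mu delta l : R.

Lemma H_le_ln2 x : 0 <= x <= 1 -> H x <= ln 2.
Proof.
move=> /andP[x0 x1]; have h2 : 0 < 2^-1 :> R by lra.
have h1 := xlnx_tangent x0 h2; have x1' : 0 <= 1 - x by lra.
have h3 := xlnx_tangent x1' h2.
rewrite H_sum; move: h1 h3; rewrite /xlnx (lnV (x := 2)) ?posrE//; lra.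
Qed.

(* [b |-> b * H (a / b)] lies below its tangent at [b']. *)
Lemma mulH_tangent a b b' : 0 <= a -> a < b -> a < b' ->
  xlnx b - xlnx (b - a) <=
  xlnx b' - xlnx (b' - a) + (b - b') * (ln b' - ln (b' - a)).
Proof.
move=> a0 ab ab'; have b0 : 0 < b by lra.
have b0' : 0 < b' by lra.
have c0 : 0 < b - a by lra.
have c0' : 0 < b' - a by lra.
have h1 := ln_le_sub1 (divr_gt0 b0 b0').
have h2 := ln_le_sub1 (divr_gt0 (mulr_gt0 b0 c0') (mulr_gt0 b0' c0)).
rewrite ln_div ?posrE// in h1.
rewrite ln_div ?posrE ?mulr_gt0// !lnM ?posrE// in h2.
have k1 : a * (ln b - ln b') <= a * (b / b' - 1) by rewrite ler_wpM2l.
have k2 : (b - a) * (ln b + ln (b' - a) - (ln b' + ln (b - a))) <=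
   (b - a) * (b * (b' - a) / (b' * (b - a)) - 1) by rewrite ler_wpM2l// ltW.
have e : a * (b / b' - 1) + (b - a) * (b * (b' - a) / (b' * (b - a)) - 1) = 0.
  by field; rewrite !gt_eqF.
by rewrite /xlnx; lra.
Qed.

Lemma E_expE mu delta : 0 <= mu -> 0 <= delta <= 2^-1 - mu ->
  E_exp mu delta = (xlnx (mu + delta) - xlnx mu - xlnx delta)
    + (xlnx (1 - mu - delta) - xlnx mu - xlnx (1 - mu - delta - mu))
    - H (2 * mu).
Proof.
move=> m0 /andP[d0 d1]; rewrite /E_exp !mulH; [|apply/andP; split; lra..].
by have -> : mu + delta - mu = delta by ring.
Qed.

(** Here [4 * mu - 1 < 0] forces [lambda = 0], and [H (2 * mu)] cancels. One half of the remaining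
    negative term is absorbed by [(1 - 2 * mu) * ln 2]; the other is compared with the second term
    of [E_exp] along a tangent whose correction has the sign of [delta - mu]. When positive, it is
    paid for by the first term of [E_exp]. *)
Lemma E_G_ge0_small mu delta l : 0 <= mu -> mu < 4^-1 -> 0 <= delta <= 2^-1 - mu ->
  lambda_ok mu l -> 0 <= E_exp mu delta + G_exp mu l.
Proof.
move=> m0 m1 dd /and3P[/andP[l0 _] okl _].
have -> : l = 0.
  move: okl; rewrite /H_arg_ok lt_eqF; last by lra.
  rewrite -[4 * mu - 1]opprB invrN mulrN => /andP[+ _].
  have : 0 < 1 - 4 * mu by lra.
  by rewrite oppr_ge0 => k /[dup] h; rewrite ler_pdivrMr// mul0r => ?; lra.
rewrite E_expE// /G_exp !mul0r subr0 addr0.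
have -> : H (0 : R) = 0 by rewrite H_sum subr0 xlnx0 xlnx1; ring.
move/andP: dd => [d0 d1].
have hq : 0 <= 2 * mu / (2 - 4 * mu) <= 1.
  rewrite divr_ge0 ?ler_pdivrMr//; lra.
have h1 : (1 - 2 * mu) * H (2 * mu / (2 - 4 * mu)) <= (1 - 2 * mu) * ln 2.
  by rewrite ler_wpM2l ?H_le_ln2//; lra.
have h2 : (1 - 2 * mu) * H (2 * mu / (2 - 4 * mu)) =
    xlnx (1 - 2 * mu) - xlnx mu - xlnx (1 - 3 * mu).
  have -> : 2 * mu / (2 - 4 * mu) = mu / (1 - 2 * mu) by field; lra.
  rewrite mulH; last by apply/andP; split; lra.
  by congr (_ - xlnx _); ring.
suff h3 : xlnx (1 - 2 * mu) - xlnx (1 - 3 * mu) - xlnx mu <=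
   (xlnx (mu + delta) - xlnx mu - xlnx delta)
    + (xlnx (1 - mu - delta) - xlnx mu - xlnx (1 - mu - delta - mu)) by lra.
have h4 : mu < 1 - 2 * mu by lra.
have h5 : mu < 1 - mu - delta by lra.
have := mulH_tangent m0 h4 h5.
have -> : 1 - 2 * mu - mu = 1 - 3 * mu by ring.
have k0 : 0 <= mu * (ln (mu + delta) - ln mu).
  move: m0; rewrite le_eqVlt => /predU1P[<-|m0]; first by rewrite mul0r.
  by rewrite mulr_ge0 ?(ltW m0)// subr_ge0 ler_ln ?posrE//; lra.
have k1 : 0 <= ln (1 - mu - delta) - ln (1 - mu - delta - mu).
  by rewrite subr_ge0 ler_ln ?posrE; lra.
have [d2|d2] := leP delta mu.
  have k2 : 0 <= (mu - delta) * (ln (1 - mu - delta) - ln (1 - mu - delta - mu)).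
    by rewrite mulr_ge0//; lra.
  have k3 : 0 <= delta * (ln (mu + delta) - ln delta).
    move: d0; rewrite le_eqVlt => /predU1P[<-|d0]; first by rewrite mul0r.
    by rewrite mulr_ge0 ?(ltW d0)// subr_ge0 ler_ln ?posrE//; lra.
  by move: k0 k1 k2 k3; rewrite /xlnx; lra.
have dp : 0 < delta by lra.
have k2 : ln (1 - mu - delta) - ln (1 - mu - delta - mu) <= ln (mu + delta) - ln delta.
  have c1 : 0 < 1 - mu - delta by lra.
  have c2 : 0 < 1 - mu - delta - mu by lra.
  have c3 : 0 < mu + delta by lra.
  suff : ln (1 - mu - delta) + ln delta <= ln (mu + delta) + ln (1 - mu - delta - mu).
    by lra.
  by rewrite -lnM ?posrE// -lnM ?posrE// ler_ln ?posrE ?mulr_gt0//; nra.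
have k3 : 0 <= delta * (ln (mu + delta) - ln delta - (ln (1 - mu - delta) - ln (1 - mu - delta - mu))).
  by rewrite mulr_ge0 ?(ltW dp)// subr_ge0.
have k4 : 0 <= mu * (ln (1 - mu - delta) - ln (1 - mu - delta - mu)) by rewrite mulr_ge0.
by move: k0 k1 k3 k4; rewrite /xlnx; lra.
Qed.
End SmallRate.

Section SineLimit.
Local Open Scope classical_set_scope.
Variable R : realType.

(** As [sin x / x] tends to 1, it exceeds [r = 2 / (pi * c) < 1] at [x = pi / p] for large [p]. *)
Lemma sin_ratio_limit (c : R) : 2 / pi < c -> exists P0 : nat, forall p : nat,
  (P0 <= p)%N -> 2 / (p%:R * sin (pi / p%:R)) <= c.
Proof.
move=> hc; have pp := pi_gt0 R.
have c0 : 0 < c by apply: lt_trans hc; rewrite divr_gt0.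
pose r := 2 / (pi * c).
have r1 : r < 1.
  by rewrite /r ltr_pdivrMr ?mulr_gt0// mul1r mulrC -ltr_pdivrMr.
have /cvgrPdist_lt h : (h^-1 *: (sin (h *: 1 + 0) - sin 0 : R^o))
    @[h --> 0^'] --> (1 : R^o).
  have := @ex_derive _ _ _ _ _ _ _ (is_derive_sin (0 : R)).
  by rewrite -{3}(cos0 R) -(@derive_val _ _ _ _ _ _ _ (is_derive_sin (0 : R))).
have e0 : 0 < 1 - r by rewrite subr_gt0.
have := h _ e0; rewrite -nbhs_nearE => /nbhs_ballP[d /= d0 hd].
exists (Num.truncn (pi / d)).+2 => p hp.
have p0 : 0 < p%:R :> R by rewrite ltr0n (leq_trans _ hp).
have x0 : 0 < pi / p%:R :> R by rewrite divr_gt0.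
have xd : pi / p%:R < d :> R.
  rewrite ltr_pdivrMr// mulrC -ltr_pdivrMr//; apply: lt_le_trans (truncnS_gt _) _.
  by rewrite ler_nat (leq_trans _ hp).
have := hd (pi / p%:R); rewrite /ball /= sub0r normrN gtr0_norm// gt_eqF// => /(_ xd isT).
rewrite addr0 sin0 subr0 => k.
have k2 : r < (pi / p%:R)^-1 * sin (pi / p%:R).
  by move: k; rewrite /GRing.scale /= mulr1 ltr_norml => /andP[_]; lra.
rewrite ltr_pdivlMl// in k2.
have k3 : 2 / c < p%:R * sin (pi / p%:R).
  rewrite -(ltr_pM2l p0) in k2; apply: le_lt_trans k2; rewrite /r.
  have fE (u w z : R) : u != 0 -> w != 0 -> z != 0 ->
      2 / w = z * (u / z * (2 / (u * w))).
    by move=> u0 w0 z0; field; rewrite u0 w0 z0.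
  by rewrite -fE ?lt0r_neq0.
have k4 : 0 < 2 / c by rewrite divr_gt0.
rewrite ler_pdivrMr; last exact: lt_trans k3.
by rewrite mulrC -ler_pdivrMr// ltW.
Qed.
End SineLimit.

(** * MDS matrices over F_2 and square MDS matrices *)

Section SpecialMDS.

Lemma row_dual_word (F : fieldType) (m n : nat) (B : 'M[F]_(m, n)) (f : 'I_n -> 'I_m) i :
  rowsub f B \in unitmx ->
  (row i B *m invmx (rowsub f B) *m rowsub f 1%:M - delta_mx 0 i) *m B = 0.
Proof.
by move=> U; rewrite mulmxBl -[_ *m rowsub f 1%:M *m B]mulmxA -rowsubE mulmxKV// -rowE subrr.
Qed.

(** Each row beyond the first [n] is a combination of those; the dual distance forces all
    coefficients to be nonzero, hence 1. Two such rows give dual words whose difference has weight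
    at most 2, so [n < 2]. *)
Lemma MDS_F2 (m n : nat) (B : 'M['F_2]_(m, n)) : is_MDS B -> (n.+2 <= m)%N -> (n < 2)%N.
Proof.
move=> mdsB nm; have [_ freeB] := mdsB.
pose f := widen_ord (leq_trans (leqnSn n) (ltnW nm)).
have injf : injective f by move=> i j /(congr1 val) /= /val_inj.
have ex_word (i : 'I_m) : (n <= i)%N -> exists2 y, y \in dual_words B &
    forall j : 'I_m, y j = if (j < n)%N || (j == i) then 1 else 0.
  move=> ni; have U : rowsub f B \in unitmx by rewrite -row_free_unit freeB.
  pose Y := row i B *m invmx (rowsub f B) *m rowsub f 1%:M - delta_mx 0 i.
  pose y := [ffun j => Y 0 j].
  have yE j : y j = Y 0 j by rewrite ffunE.
  have yD : y \in dual_words B.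
    rewrite inE (_ : \row_j y j = Y); last by apply/rowP => j; rewrite mxE yE.
    exact/eqP/row_dual_word.
  have Yout (j : 'I_m) : (n <= j)%N -> Y 0 j = - (j == i)%:R.
    move=> nj; rewrite !mxE eqxx big1 ?sub0r// => k _; rewrite !mxE.
    by rewrite (_ : _ == j = false) ?mulr0//; apply/eqP => /(congr1 val) /= e;
       move: nj; rewrite -e leqNgt ltn_ord.
  have y0 : y != 0.
    apply/eqP => /ffunP /(_ i); rewrite yE Yout// eqxx ffunE => /eqP.
    by rewrite oppr_eq0 oner_eq0.
  pose T := i |: f @: [set: 'I_n].
  have cT : #|T| = n.+1.
    rewrite cardsU1 card_imset// [#|setT|]cardsT card_ord (_ : i \notin _) ?add1n//.
    apply/imsetP => -[k _] /(congr1 val) /= e.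
    by move: ni; rewrite e leqNgt ltn_ord.
  have TE j : (j \in T) = (j < n)%N || (j == i).
    rewrite !inE orbC; congr (_ || _); apply/imsetP/idP => [[k _ ->] /=|jn].
      exact: ltn_ord.
    by exists (Ordinal jn) => //; exact: val_inj.
  (* The support lies in the [n.+1] positions of [T] and has more than [n] elements. *)
  have sT : fsupp y = T.
    apply/eqP; rewrite eqEcard cT (dual_words_dist mdsB)// andbT.
    apply/subsetP => j; rewrite inE TE yE; have [//|nj] := ltnP j n.
    by rewrite Yout// oppr_eq0 /=; case: (j == i); rewrite ?eqxx.
  exists y => // j; have := TE j; rewrite -sT inE.
  case: ifP => _; last by move/negbFE/eqP.
  by case: (y j) => -[|[|//]] h // _; exact: val_inj.
have mn1 : (n < m)%N by exact: ltnW.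
have [y1 y1D y1E] := ex_word (Ordinal mn1) (leqnn _).
have [y2 y2D y2E] := ex_word (Ordinal nm) (leqnSn _).
have y0 : y1 - y2 != 0.
  apply/eqP => /ffunP /(_ (Ordinal nm)); rewrite !ffunE.
  have -> : y1 (Ordinal nm) = 0.
    by rewrite y1E /= ltnNge leqnSn /= -val_eqE /= eqn_leq ltnn.
  by rewrite y2E eqxx orbT => /eqP; rewrite sub0r oppr_eq0 oner_eq0.
have := dual_words_dist mdsB (dual_wordsB y1D y2D) y0.
move=> /leq_trans -> //; apply: (@leq_trans #|[set Ordinal mn1; Ordinal nm]|).
  apply: subset_leq_card; apply/subsetP => j; rewrite !inE !ffunE y1E y2E.
  by case: (j < n)%N; case: (j == Ordinal mn1); case: (j == Ordinal nm).
by rewrite cards2; case: (_ != _).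
Qed.

Lemma MDS_square_sat (R : realType) (F : finFieldType) (m : nat) (B : 'M[F]_(m, m))
    (S : 'I_m -> {set F}) : (0 < m)%N -> is_MDS B -> (forall i, (0 < #|S i|)%N) ->
  exists x : 'cV[F]_m, sat_ratio R B S x = 1.
Proof.
move=> m0 [_ /(_ id (fun _ _ => id))]; rewrite row_free_unit => U S0.
have U' : B \in unitmx by have := U; rewrite (_ : rowsub id B = B)//; apply/matrixP => i j; rewrite mxE.
have s_ex i : exists z, z \in S i by apply/card_gt0P.
exists (invmx B *m \col_i xchoose (s_ex i)).
rewrite /sat_ratio mulKVmx// (_ : [set i | _] = setT).
  by rewrite cardsT card_ord divff// pnatr_eq0 -lt0n.
by apply/setP => i; rewrite !inE mxE; exact: xchooseP.
Qed.
End SpecialMDS.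

(** * Binomial coefficients *)

Section BinomialBounds.

(** The weights [K ^ i / i!] of a Poisson law of mean [K] are largest at [i = K]. *)
Lemma fact_expn_le K i : (K`! * K ^ i <= i`! * K ^ K)%N.
Proof.
case: K => [|K]; first by rewrite fact0 mul1n expn0 muln1; case: i => // i; rewrite exp0n.
have [Ki|iK] := leqP K.+1 i.
  rewrite -(subnK Ki) addnC; elim: (i - K.+1)%N => [|d IHd]; first by rewrite addn0.
  rewrite addnS (expnS _ (_ + _)) (factS (_ + _)) mulnCA -mulnA; apply: leq_mul => //.
  by rewrite ltnS leqW ?leq_addr.
have {iK} iK := ltnW iK; rewrite -(subKn iK); move: (K.+1 - i)%N (leq_subr i K.+1).
elim=> [|d IHd] dK; first by rewrite subn0.
have {}IHd := IHd (ltnW dK).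
rewrite -(leq_pmul2l (m := K.+1))//; have e : (K.+1 - d = (K.+1 - d.+1).+1)%N by lia.
rewrite e factS expnS in IHd.
apply: leq_trans (_ : (K.+1 - d.+1).+1 * (K.+1 - d.+1)`! * K.+1 ^ K.+1 <= _)%N.
  by apply: leq_trans IHd; rewrite mulnCA.
rewrite mulnA leq_mul2r leq_mul2r; apply/orP; right; apply/orP; right; lia.
Qed.

Lemma bin_expn_le N K : (K <= N)%N ->
  ('C(N, K) * (K ^ K * (N - K) ^ (N - K)) <= N ^ N)%N.
Proof.
move=> KN; rewrite -{4}(subnK KN) expnDn.
rewrite (bigD1 (Ordinal (KN : (K < N.+1)%N)))//= mulnC [(K ^ K * _)%N]mulnC mulnC.
exact: leq_addr.
Qed.

(** Among the [N.+1] terms of the expansion of [(K + (N - K)) ^ N], the one of index [K] is the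
    largest. *)
Lemma expn_bin_le N K : (K <= N)%N ->
  (N ^ N <= N.+1 * ('C(N, K) * (K ^ K * (N - K) ^ (N - K))))%N.
Proof.
move=> KN; rewrite -{1}(subnK KN) expnDn.
rewrite -[X in (_ <= X * _)%N]card_ord -sum_nat_const; apply: leq_sum => i _.
have iN : (i <= N)%N by rewrite -ltnS.
have h1 := fact_expn_le K i; have h2 := fact_expn_le (N - K) (N - i).
have e1 := bin_fact KN; have e2 := bin_fact iN.
have p1 : (0 < K`! * (N - K)`! * (i`! * (N - i)`!))%N by rewrite !muln_gt0 !fact_gt0.
rewrite -(leq_pmul2l p1).
have -> : (K`! * (N - K)`! * (i`! * (N - i)`!) * ('C(N, i) * ((N - K) ^ (N - i) * K ^ i))
  = 'C(N, i) * (i`! * (N - i)`!) * ((K`! * K ^ i) * ((N - K)`! * (N - K) ^ (N - i))))%N.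
  by ring.
have -> : (K`! * (N - K)`! * (i`! * (N - i)`!) * ('C(N, K) * (K ^ K * (N - K) ^ (N - K)))
  = 'C(N, K) * (K`! * (N - K)`!) * ((i`! * K ^ K) * ((N - i)`! * (N - K) ^ (N - K))))%N.
  by ring.
by rewrite e1 e2 leq_mul2l leq_mul// orbT.
Qed.

Variable R : realType.
Implicit Types (m n N K : nat).

Lemma ln_expn_self N : ln (N ^ N)%:R = xlnx N%:R :> R.
Proof.
case: N => [|N]; first by rewrite expn0 ln1 xlnx0.
by rewrite natrX lnXn ?ltr0n// /xlnx mulr_natl.
Qed.

Lemma ln_binE N K : (K <= N)%N ->
  ln ('C(N, K) * (K ^ K * (N - K) ^ (N - K)))%:R
  = ln 'C(N, K)%:R + (xlnx K%:R + xlnx (N - K)%:R) :> R.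
Proof.
move=> KN; have pos a : (0 < a ^ a)%N by case: a => // a; rewrite expn_gt0.
rewrite natrM lnM ?posrE ?ltr0n ?bin_gt0 ?muln_gt0 ?pos//.
by rewrite natrM lnM ?posrE ?ltr0n ?pos// !ln_expn_self.
Qed.

Lemma xlnx_scale (M x : R) : 0 < M -> 0 <= x -> xlnx x = x * ln M + M * xlnx (x / M).
Proof.
move=> M0 x0; have := xlnxM M0 (divr_ge0 x0 (ltW M0)).
rewrite mulrC divfK ?gt_eqF// => ->.
have -> : x / M * xlnx M = x * ln M by rewrite /xlnx; field; rewrite gt_eqF.
by [].
Qed.

Lemma ln_bin_le m N K : (0 < m)%N -> (K <= N)%N ->
  ln 'C(N, K)%:R <= m%:R * (xlnx (N%:R / m%:R) - xlnx (K%:R / m%:R)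
                            - xlnx ((N - K)%:R / m%:R)) :> R.
Proof.
move=> m0 KN; have M0 : 0 < m%:R :> R by rewrite ltr0n.
have : ln ('C(N, K) * (K ^ K * (N - K) ^ (N - K)))%:R <= ln (N ^ N)%:R :> R.
  have pos a : (0 < a ^ a)%N by case: a => // a; rewrite expn_gt0.
  rewrite ler_ln ?posrE ?ltr0n ?muln_gt0 ?bin_gt0 ?KN ?pos//.
  by rewrite ler_nat bin_expn_le.
rewrite ln_binE// ln_expn_self.
rewrite (xlnx_scale M0 (ler0n _ N)) (xlnx_scale M0 (ler0n _ K)) (xlnx_scale M0 (ler0n _ (N - K)%N)).
have -> : (N%:R : R) * ln m%:R = K%:R * ln m%:R + (N - K)%:R * ln m%:R.
  by rewrite -mulrDl -natrD subnKC.
by move=> h; lra.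
Qed.

Lemma ln_bin_ge m N K : (0 < m)%N -> (K <= N)%N ->
  m%:R * (xlnx (N%:R / m%:R) - xlnx (K%:R / m%:R) - xlnx ((N - K)%:R / m%:R))
  <= ln 'C(N, K)%:R + ln N.+1%:R :> R.
Proof.
move=> m0 KN; have M0 : 0 < m%:R :> R by rewrite ltr0n.
have pos a : (0 < a ^ a)%N by case: a => // a; rewrite expn_gt0.
have : ln (N ^ N)%:R <= ln (N.+1 * ('C(N, K) * (K ^ K * (N - K) ^ (N - K))))%:R :> R.
  rewrite ler_ln ?posrE ?ltr0n ?muln_gt0 ?bin_gt0 ?KN ?pos//.
  by rewrite ler_nat expn_bin_le.
rewrite [(N.+1 * _)%:R]natrM lnM ?posrE ?ltr0n ?muln_gt0 ?bin_gt0 ?KN ?pos//.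
rewrite ln_binE// ln_expn_self.
rewrite (xlnx_scale M0 (ler0n _ N)) (xlnx_scale M0 (ler0n _ K)) (xlnx_scale M0 (ler0n _ (N - K)%N)).
have -> : (N%:R : R) * ln m%:R = K%:R * ln m%:R + (N - K)%:R * ln m%:R.
  by rewrite -mulrDl -natrD subnKC.
by move=> h; lra.
Qed.
End BinomialBounds.

(** * The coefficients of Q and their correlations *)

Section Window.
Variables (R : realType) (m L a : nat).
Hypothesis L0 : (0 < L)%N.
Hypothesis aLm : (a + L <= m.+1)%N.
Implicit Types (A B : {set 'I_m}) (k : nat).

(** The squares over all sets of size [k] add up to 1, so each level of the window has unit norm. *)
Definition window k : R :=
  if (a <= k < a + L)%N then (Num.sqrt 'C(m, k)%:R)^-1 else 0.

Definition window_weight A : R := window #|A|.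

Lemma window_ge0 k : 0 <= window k.
Proof. by rewrite /window; case: ifP => // _; rewrite invr_ge0 sqrtr_ge0. Qed.

Lemma window_sqr k : window k ^+ 2 = if (a <= k < a + L)%N then 'C(m, k)%:R^-1 else 0.
Proof. by rewrite /window; case: ifP => _; rewrite ?expr0n// exprVn sqr_sqrtr. Qed.

Lemma sum_subset_card (F : nat -> R) B :
  \sum_(A : {set 'I_m} | A \subset B) F #|A| = \sum_(0 <= k < #|B|.+1) 'C(#|B|, k)%:R * F k.
Proof.
rewrite big_mkord.
rewrite (partition_big (fun A : {set 'I_m} => inord #|A| : 'I_#|B|.+1) xpredT)//=.
apply: eq_bigr => k _.
rewrite -(cards_draws B k) mulr_natl -sumr_const; apply: eq_big => [A|A].
  rewrite inE; case: (boolP (A \subset B)) => //= AB.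
  by rewrite -val_eqE /= inordK// ltnS subset_leq_card.
case/andP=> AB /eqP <-; by rewrite inordK// ltnS subset_leq_card.
Qed.

Lemma sum_window (F : nat -> R) b c N : (b <= c)%N -> (c <= N)%N ->
  (forall k, ~~ (b <= k < c)%N -> F k = 0) ->
  \sum_(0 <= k < N) F k = \sum_(b <= k < c) F k.
Proof.
move=> bc cN F0.
have z1 : \sum_(0 <= k < b) F k = 0.
  rewrite big_nat_cond big1// => k /andP[/andP[_ kb] _].
  by apply: F0; rewrite negb_and -ltnNge kb.
have z2 : \sum_(c <= k < N) F k = 0.
  rewrite big_nat_cond big1// => k /andP[/andP[ck _] _].
  by apply: F0; rewrite negb_and -leqNgt ck orbT.
rewrite (big_cat_nat (n := b))//=; last exact: leq_trans cN.
by rewrite z1 add0r (big_cat_nat (n := c))//= z2 addr0.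
Qed.

Lemma autocorr_window0 : autocorr window_weight set0 = L%:R.
Proof.
have -> : autocorr window_weight set0 = \sum_(A : {set 'I_m} | A \subset setT) window #|A| ^+ 2.
  rewrite /autocorr; apply: eq_big => [A|A _]; first by rewrite subsetT.
  by rewrite (_ : symd A set0 = A) ?expr2//; apply/setP => i; rewrite !inE; case: (i \in A).
rewrite (sum_subset_card (fun k => window k ^+ 2)) cardsT card_ord.
rewrite (@sum_window _ a (a + L)) ?leq_addr//; last first.
  by move=> k /negbTE e; rewrite window_sqr e mulr0.
rewrite (eq_big_nat _ _ (F2 := fun=> 1)) => [|k kw].
  by rewrite big_const_nat addKn iter_addr addr0.
rewrite window_sqr kw mulfV// pnatr_eq0 -lt0n bin_gt0.
by rewrite -ltnS (leq_trans _ aLm)//; case/andP: kw.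
Qed.

(** Pairs [A], [i |: A] with [#|A| = k] contribute ['C(m.-1, k) / sqrt ('C(m, k) * 'C(m, k.+1))],
    that is [sqrt ((m - k) * k.+1) / m]. The factor 2 counts both orders, and [L.-1] levels have
    their successor in the window. *)
Lemma autocorr_window1 i (r : R) : (0 < m)%N -> 0 <= r ->
  (forall k, (a <= k)%N -> (k.+1 < a + L)%N ->
     r ^+ 2 * m%:R ^+ 2 <= (m - k)%:R * k.+1%:R) ->
  2 * (L.-1)%:R * r <= autocorr window_weight [set i].
Proof.
move=> m0 r0 hr; have M0 : 0 < m%:R :> R by rewrite ltr0n.
have symdC A B : symd A B = symd B A by apply/setP => j; rewrite !inE eq_sym.
pose F k := window k * window k.+1.
have half : \sum_(A : {set 'I_m} | i \notin A) F #|A| <=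
    \sum_(A : {set 'I_m} | i \notin A) window_weight A * window_weight (symd A [set i]).
  apply: ler_sum => A iA; rewrite /window_weight (_ : symd A [set i] = i |: A).
    by rewrite cardsU1 iA.
  apply/setP => j; rewrite !inE; have [->|_] := eqVneq j i; first by rewrite (negbTE iA).
  by case: (j \in A).
have -> : autocorr window_weight [set i] =
  2 * \sum_(A : {set 'I_m} | i \notin A) window_weight A * window_weight (symd A [set i]).
  rewrite /autocorr (bigID (fun A : {set 'I_m} => i \in A)) /=.
  rewrite (reindex_inj (inv_inj (symdK [set i]))) /=.
  rewrite mulr_natl mulr2n; congr (_ + _).
  apply: eq_big => [A|A _]; first by rewrite !inE eqxx; case: (i \in A).
  by rewrite [symd (symd _ _) _]symdC symdK mulrC symdC.
rewrite -mulrA ler_wpM2l//; apply: le_trans half.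
have -> : \sum_(A : {set 'I_m} | i \notin A) F #|A| =
    \sum_(A : {set 'I_m} | A \subset ~: [set i]) F #|A|.
  by apply: eq_bigl => A; rewrite subsetC sub1set inE.
rewrite sum_subset_card cardsCs setCK cards1 card_ord subn1 prednK//.
rewrite (@sum_window _ a (a + L.-1)) ?leq_addr//; last 2 first.
  by rewrite -ltnS -addnS prednK.
  move=> k; rewrite negb_and -!ltnNge => /orP[ka|ka].
    by rewrite /F /window leqNgt ka /= mul0r mulr0.
  rewrite /F /window [in X in _ * (_ * X)]ifF ?mulr0//; apply/negbTE.
  by rewrite negb_and -!leqNgt; apply/orP; right; lia.
have -> : (L.-1)%:R * r = \sum_(a <= k < a + L.-1) r.
  by rewrite big_const_nat addKn iter_addr addr0 mulr_natl.
apply: ler_sum_nat => k /andP[ak kaL].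
have k1 : (k.+1 < a + L)%N by lia.
have km : (k < m)%N by lia.
rewrite /F /window ak (ltnW k1) k1 (leqW ak) /=.
have x0 : 0 < 'C(m, k)%:R :> R by rewrite ltr0n bin_gt0 ltnW.
have z0 : 0 < 'C(m, k.+1)%:R :> R by rewrite ltr0n bin_gt0.
have e1 : 'C(m.-1, k)%:R * m%:R = 'C(m, k)%:R * (m - k)%:R :> R.
  rewrite -!natrM; congr (_%:R); case: m m0 km => // m' _ km /=.
  by have := mul_bin_down m'.+1 k; rewrite /= => e; rewrite mulnC e mulnC.
have e2 : 'C(m.-1, k)%:R * m%:R = 'C(m, k.+1)%:R * k.+1%:R :> R.
  rewrite -!natrM; congr (_%:R); case: m m0 km => // m' _ km /=.
  by have := mul_bin_diag m'.+1 k; rewrite /= => e; rewrite mulnC e mulnC.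
rewrite -invfM -(sqrtrM _ (ltW x0)) ler_pdivlMr ?sqrtr_gt0 ?mulr_gt0//.
rewrite -(ler_pXn2r (n := 2))// ?nnegrE ?mulr_ge0 ?sqrtr_ge0//.
rewrite exprMn sqr_sqrtr ?mulr_ge0 ?(ltW x0) ?(ltW z0)//.
rewrite -(ler_pM2r (exprn_gt0 2 M0)) -[leRHS]exprMn [leRHS]expr2 [X in _ <= X * _]e1 [X in _ <= _ * X]e2.
have := ler_wpM2l (mulr_ge0 (ltW x0) (ltW z0)) (hr k ak k1); lra.
Qed.
End Window.

(** * Exponential rates *)

Section Rates.
Variable R : realType.
Implicit Types (mu delta l y c g : R).

Lemma le_expR_ln (x z : R) : 0 < x -> ln x <= z -> x <= expR z.
Proof. by move=> x0 h; rewrite -[x]lnK ?posrE// ler_expR. Qed.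

(** The left side is stationary at [y ^+ 2 = delta / (1 - 2 * mu - delta)], which is at most 1 as
    [delta <= 1/2 - mu]. For [delta = 0] this would give [y = 0], so a small positive [y] is taken
    at the cost of [g]. *)
Lemma exists_tilt mu delta g : 4^-1 <= mu -> mu < 2^-1 -> 0 <= delta <= 2^-1 - mu ->
  0 < g -> exists2 y, 0 < y <= 1 &
  2 * mu * ln (2 * y) + (1 - 2 * mu) * ln (1 + y ^+ 2) - 2 * (mu + delta) * ln y <=
  2 * mu * ln 2 + xlnx (1 - 2 * mu) - xlnx delta - xlnx (1 - mu - delta - mu) + g.
Proof.
move=> m1 m2 /andP[d0 d1] g0.
have lnD y : 0 < y -> ln (2 * y) = ln 2 + ln y by move=> y0; rewrite lnM ?posrE.
move: d0; rewrite le_eqVlt => /predU1P[<-|d0].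
  pose y := Num.min 1 g.
  have y0 : 0 < y by rewrite lt_min ltr01.
  have y1 : y <= 1 by rewrite ge_min lexx.
  have yg : y <= g by rewrite ge_min lexx orbT.
  exists y; rewrite ?y0// lnD// xlnx0.
  have -> : 1 - mu - 0 - mu = 1 - 2 * mu by ring.
  have h1 : ln (1 + y ^+ 2) <= y ^+ 2.
    by apply: le_ln1Dx; apply: lt_le_trans (sqr_ge0 _); lra.
  have h2 : y ^+ 2 <= y by rewrite expr2 ger_pMr.
  have h3 : 0 <= ln (1 + y ^+ 2) by rewrite ln_ge0// lerDl sqr_ge0.
  have h4 : 0 <= 2 * mu * ln (1 + y ^+ 2) by rewrite mulr_ge0//; lra.
  by lra.
pose b := 1 - mu - delta - mu; have b0 : 0 < b by rewrite /b; lra.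
pose x := delta / b; have x0 : 0 < x by rewrite divr_gt0.
have x1 : x <= 1 by rewrite ler_pdivrMr// /b; lra.
have s0 : 0 < Num.sqrt x by rewrite sqrtr_gt0.
exists (Num.sqrt x); first by rewrite s0 -[leRHS]sqrtr1 ler_sqrt.
rewrite lnD// sqr_sqrtr ?(ltW x0)//.
have -> : 1 + x = (1 - 2 * mu) / b.
  have -> : 1 - 2 * mu = b + delta by rewrite /b; ring.
  by rewrite mulrDl divff ?gt_eqF.
have lx : ln x = 2 * ln (Num.sqrt x).
  by rewrite -{1}(sqr_sqrtr (ltW x0)) lnXn// mulr_natl.
have : ln x = ln delta - ln b by rewrite ln_div ?posrE.
rewrite [ln ((1 - 2 * mu) / b)]ln_div ?posrE//; last by lra.
rewrite lx -/b /xlnx => e.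
have -> : ln (Num.sqrt x) = (ln delta - ln b) / 2 by lra.
have eb : b * ln b = (1 - mu - delta - mu) * ln b by [].
by lra.
Qed.

Lemma exists_base g : 0 < g -> exists2 c : R, 2 / pi < c <= 1 & ln c <= ln (2 / pi) + g.
Proof.
move=> g0; have /andP[c1 c2] := two_div_pi_bounds R.
have p0 : 0 < 2 / pi :> R by lra.
exists (Num.min 1 (2 / pi * expR g)).
  rewrite lt_min c2 /= ltr_pMr// expR_gt1 g0/= ge_min lexx//.
rewrite -[X in _ + X]expRK -lnM ?posrE ?expR_gt0// ler_ln ?posrE.
- by rewrite ge_min lexx orbT.
- by rewrite lt_min ltr01 mulr_gt0 ?expR_gt0.
- by rewrite mulr_gt0 ?expR_gt0.
Qed.

Lemma inv_bin_le (m k L : nat) (a : R) : (0 < m)%N -> (k <= m)%N -> 0 <= a <= 1 ->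
  `|k%:R - a * m%:R| <= L%:R ->
  'C(m, k)%:R^-1 <= m.+1%:R *
    expR (m%:R * (xlnx a + xlnx (1 - a)) + (2 + `|ln a| + `|ln (1 - a)|) * L%:R).
Proof.
move=> m0 km /andP[a0 a1] kL; have M0 : 0 < m%:R :> R by rewrite ltr0n.
have Mn := lt0r_neq0 M0.
have C0 : 0 < 'C(m, k)%:R :> R by rewrite ltr0n bin_gt0.
have M1 : 0 < m.+1%:R :> R by rewrite ltr0n.
rewrite mulrC -ler_pdivrMr//; apply: le_expR_ln; first by rewrite divr_gt0 ?invr_gt0.
rewrite ln_div ?posrE ?invr_gt0// lnV ?posrE//.
have := ln_bin_ge R m0 km; rewrite divff// xlnx1 natrB// mulrBl divff//.
set x := k%:R / m%:R.
have xE : k%:R = x * m%:R :> R by rewrite divfK.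
have x0 : 0 <= x by rewrite divr_ge0.
have x1 : x <= 1 by rewrite ler_pdivrMr// mul1r ler_nat.
have d : m%:R * `|x - a| <= L%:R.
  by rewrite -[X in X * _](gtr0_norm M0) -normrM mulrC mulrBl -xE.
have h1 : xlnx x <= xlnx a + (1 + `|ln a|) * `|x - a| by apply: xlnx_upper; rewrite ?x0.
have h2 : xlnx (1 - x) <= xlnx (1 - a) + (1 + `|ln (1 - a)|) * `|x - a|.
  have -> : `|x - a| = `|1 - x - (1 - a)| by rewrite distrC; congr `|_|; ring.
  by apply: xlnx_upper; [lra|apply/andP; split; lra].
have h3 := ler_wpM2l (ltW M0) (lerD h1 h2).
have h4 : (2 + `|ln a| + `|ln (1 - a)|) * (m%:R * `|x - a|) <=
    (2 + `|ln a| + `|ln (1 - a)|) * L%:R by rewrite ler_wpM2l// !addr_ge0.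
by lra.
Qed.

Lemma tilt_exp_le (m n l0 : nat) mu (a y : R) : (0 < m)%N -> n%:R = 2 * mu * m%:R ->
  (n <= m)%N -> l0%:R <= a * m%:R -> 0 < y <= 1 ->
  (2 * y) ^+ n * (1 + y ^+ 2) ^+ (m - n) / y ^+ (2 * l0) <=
  expR (m%:R * (2 * mu * ln (2 * y) + (1 - 2 * mu) * ln (1 + y ^+ 2) - 2 * a * ln y)).
Proof.
move=> m0 nE nm la /andP[y0 y1].
have q0 : 0 < 1 + y ^+ 2 by rewrite ltr_pwDl// sqr_ge0.
have y20 : 0 < 2 * y by rewrite mulr_gt0.
apply: le_expR_ln; first by rewrite divr_gt0 ?mulr_gt0 ?exprn_gt0.
rewrite ln_div ?posrE ?mulr_gt0 ?exprn_gt0// lnM ?posrE ?exprn_gt0//.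
rewrite !lnXn// -[_ *+ n]mulr_natl -[_ *+ (m - n)]mulr_natl -[_ *+ (2 * l0)]mulr_natl.
rewrite natrM natrB// nE.
have h : 0 <= (a * m%:R - l0%:R) * - ln y by rewrite mulr_ge0 ?oppr_ge0 ?ln_le0// subr_ge0.
by lra.
Qed.

(** With [r = 2 * n - m], the quotient ['C(m, r) / ('C(n, t) * 'C(m - n, r - t))] equals
    ['C(m, n) / ('C(r, t) * 'C(m - r, n - t))], the form behind [G_exp]; in terms of [xlnx] both
    agree. Rounding [l * m] down to [t] costs a constant factor. *)
Lemma dual_bound_le (m n : nat) mu l c g : (0 < m)%N -> n%:R = 2 * mu * m%:R ->
  4^-1 <= mu -> 2 * mu <= 1 -> lambda_ok mu l -> 2 / pi < c <= 1 ->
  0 <= g -> ln c <= ln (2 / pi) + g ->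
  let t := Num.truncn (l * m%:R) in
  [/\ (m <= 2 * n)%N, (n <= m)%N, (t <= 2 * n - m)%N,
    (0 < 'C(n, t) * 'C(m - n, 2 * n - m - t))%N &
  dual_bound m n c t <= m.+1%:R ^+ 2 *
    expR (m%:R * (G_exp mu l + g) + (- ln (2 / pi) + (4 + `|ln l| + `|ln (2 * mu - l)| +
       `|ln (4 * mu - 1 - l)| + `|ln (2 - 6 * mu + l)|)))].
Proof.
move=> m0 nE m1 m2 okl /andP[c1 c2] g0 lc t.
have M0 : 0 < m%:R :> R by rewrite ltr0n.
have Mn := lt0r_neq0 M0.
have [l0 l1 l2] := (lambda_okP _ m1 m2).1 okl.
have c0 : 0 < c by apply: lt_trans c1; rewrite divr_gt0 ?pi_gt0.
have mn : (m <= 2 * n)%N by rewrite -(ler_nat R) natrM nE; nra.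
have nm : (n <= m)%N by rewrite -(ler_nat R) nE; nra.
have rE : (2 * n - m)%:R = (4 * mu - 1) * m%:R :> R by rewrite natrB// natrM nE; ring.
have /andP[t1 t2] := truncn_itv (mulr_ge0 l0 (ltW M0)); rewrite -/t -natr1 in t1 t2.
clearbody t.
have [lp lpE] : exists lp, lp = ln (2 / pi) :> R by exists (ln (2 / pi)).
rewrite -lpE in lc *.
have tr : (t <= 2 * n - m)%N.
  by rewrite -(ler_nat R) rE; apply: le_trans t1 _; rewrite ler_pM2r.
(* Rounding down could spoil [6 * mu - 2 <= l], but [3 * n - 2 * m] is an integer below [t.+1]. *)
have rt : (2 * n - m - t <= m - n)%N.
  have : (3 * n - 2 * m < t.+1)%N.
    rewrite -(ltr_nat R); have [h|h] := leqP (2 * m) (3 * n); last first.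
      by rewrite (eqP (_ : 3 * n - 2 * m == 0)%N) ?ltr0n// subn_eq0 ltnW.
    rewrite natrB// !natrM nE -[t.+1%:R]natr1; apply: le_lt_trans t2.
    have : (6 * mu - 2) * m%:R <= l * m%:R by rewrite ler_pM2r.
    by lra.
  by move: nm; clear; lia.
have tn : (t <= n)%N by move: tr nm; clear; lia.
have bpos : (0 < 'C(n, t) * 'C(m - n, 2 * n - m - t))%N by rewrite muln_gt0 !bin_gt0 tn.
split=> //.
have M1 : 0 < m.+1%:R :> R by rewrite ltr0n.
have b1 : 0 < 'C(n, t)%:R :> R by rewrite ltr0n bin_gt0.
have b2 : 0 < 'C(m - n, 2 * n - m - t)%:R :> R by rewrite ltr0n bin_gt0.
have b3 : 0 < 'C(m, 2 * n - m)%:R :> R by rewrite ltr0n bin_gt0; move: nm; clear; lia.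
rewrite mulrC -ler_pdivrMr ?exprn_gt0//; apply: le_expR_ln.
  rewrite /dual_bound natrM !divr_gt0 ?mulr_gt0 ?exprn_gt0//.
rewrite /dual_bound natrM ln_div ?posrE ?divr_gt0 ?mulr_gt0 ?exprn_gt0//.
rewrite ln_div ?posrE ?mulr_gt0 ?exprn_gt0// !lnM ?posrE ?mulr_gt0 ?exprn_gt0//.
rewrite !lnXn// -[_ *+ t]mulr_natr -[_ *+ (m - n)]mulr_natr.
have r_le : (2 * n - m <= m)%N by move: nm; clear; lia.
have h1 := ln_bin_le R m0 r_le; have h2 := ln_bin_ge R m0 tn; have h3 := ln_bin_ge R m0 rt.
have M1n : ln n.+1%:R <= ln m.+1%:R :> R by rewrite ler_ln ?posrE ?ltr0n// ler_nat.
have M2n : ln (m - n).+1%:R <= ln m.+1%:R :> R.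
  by rewrite ler_ln ?posrE ?ltr0n// ler_nat ltnS leq_subr.
rewrite divff// xlnx1 rE mulfK// (natrB _ r_le) rE mulrBl divff// mulfK// in h1.
rewrite nE mulfK// (natrB _ tn) nE mulrBl mulfK// in h2.
rewrite (natrB _ rt) (natrB _ tr) rE (natrB _ nm) nE !mulrBl divff// !mulfK// in h3.
set x := t%:R / m%:R in h2 h3.
have xE : t%:R = x * m%:R :> R by rewrite divfK.
have x0 : 0 <= x by rewrite divr_ge0.
have xl : x <= l by rewrite ler_pdivrMr.
have dx : m%:R * `|x - l| <= 1.
  rewrite ler0_norm ?subr_le0// opprB mulrBr [m%:R * x]mulrC -xE; lra.
have x1 : 6 * mu - 2 <= x.
  rewrite ler_pdivlMr//; have : (2 * n - m - t)%:R <= (m - n)%:R :> R by rewrite ler_nat.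
  by rewrite (natrB _ tr) rE (natrB _ nm) nE; lra.
have k1 : xlnx x <= xlnx l + (1 + `|ln l|) * `|x - l|.
  by apply: xlnx_upper => //; apply/andP; split; lra.
have k2 : xlnx (2 * mu - x) <= xlnx (2 * mu - l) + (1 + `|ln (2 * mu - l)|) * `|x - l|.
  have -> : `|x - l| = `|2 * mu - x - (2 * mu - l)| by rewrite distrC; congr `|_|; ring.
  by apply: xlnx_upper; [lra|apply/andP; split; lra].
have k3 : xlnx (4 * mu - 1 - x) <=
    xlnx (4 * mu - 1 - l) + (1 + `|ln (4 * mu - 1 - l)|) * `|x - l|.
  have -> : `|x - l| = `|4 * mu - 1 - x - (4 * mu - 1 - l)| by rewrite distrC; congr `|_|; ring.
  by apply: xlnx_upper; [lra|apply/andP; split; lra].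
have k4 : xlnx (2 - 6 * mu + x) <=
    xlnx (2 - 6 * mu + l) + (1 + `|ln (2 - 6 * mu + l)|) * `|x - l|.
  have -> : `|x - l| = `|2 - 6 * mu + x - (2 - 6 * mu + l)| by congr `|_|; ring.
  by apply: xlnx_upper; [lra|apply/andP; split; lra].
have k := ler_wpM2l (ltW M0) (lerD (lerD k1 k2) (lerD k3 k4)).
set Kl := 4 + _ + _ + _ + _.
have kk : Kl * (m%:R * `|x - l|) <= Kl * 1 by rewrite ler_wpM2l// /Kl !addr_ge0.
rewrite {}/Kl in kk *.
have lnc0 : ln c <= 0 by rewrite ln_le0.
have e1 : 1 - 2 * mu - (4 * mu - 1 - x) = 2 - 6 * mu + x by ring.
have e2 : 1 - (4 * mu - 1) = 2 - 4 * mu by ring.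
rewrite e1 in h3; rewrite e2 in h1.
(* [t] falls short of [l * m] by less than 1, which costs at most [- ln c <= - lp]. *)
have kc : ln c * t%:R <= m%:R * (l * (lp + g)) - lp.
  have g1 : 0 <= (t%:R + 1 - l * m%:R) * - ln c by rewrite mulr_ge0 ?oppr_ge0//; lra.
  have g2 : 0 <= l * m%:R * (lp + g - ln c) by rewrite !mulr_ge0 ?subr_ge0 ?(ltW M0).
  have g3 : lp <= ln c by rewrite lpE ler_ln ?posrE ?divr_gt0 ?pi_gt0 ?(ltW c1).
  by lra.
have gl : 0 <= m%:R * ((1 - l) * g) by rewrite !mulr_ge0 ?(ltW M0)//; lra.
rewrite (G_expE m1 m2 okl) -lpE (natrB _ nm) nE.
move: k kk h1 h2 h3 M1n M2n kc gl; clear; move=> k kk h1 h2 h3 M1n M2n kc gl.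
by lra.
Qed.
End Rates.

(** * Choice of the parameters and conclusion *)

Section Assembly.
Variable R : realType.
Implicit Types (mu delta l y c g eps : R).

(** The fourth power of [1 + g * m / 4 <= expR (g * m / 4)] beats the cubic factor by one degree. *)
Lemma exp_rate_le (C0 C1 g a : R) : 0 <= C0 -> 0 < g -> 0 < a ->
  exists M : nat, forall m : nat, (M <= m)%N ->
    C0 * (m.+1%:R ^+ 3 * expR (C1 - g * m%:R)) <= a.
Proof.
move=> C00 g0 a0; pose h := Num.min 1 (g / 4).
have h0 : 0 < h by rewrite lt_min ltr01 divr_gt0.
have h1 : h <= 1 by rewrite ge_min lexx.
have hg : h <= g / 4 by rewrite ge_min lexx orbT.
pose D := C0 * expR C1 / (h ^+ 4 * a).
exists (Num.truncn D).+1 => m Mm.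
have D0 : 0 <= D by rewrite divr_ge0 ?mulr_ge0 ?expR_ge0 ?exprn_ge0 ?(ltW h0) ?(ltW a0).
have Dm : D <= m%:R.
  by apply/ltW/(lt_le_trans (truncnS_gt _)); rewrite ler_nat.
have m1 : 0 < m.+1%:R :> R by rewrite ltr0n.
have e4 : (h * m.+1%:R) ^+ 4 <= expR (g * m%:R).
  have -> : g * m%:R = 4%:R * (g * m%:R / 4) by field.
  rewrite expRM_natl; apply: lerXn2r; rewrite ?nnegrE ?expR_ge0 ?mulr_ge0 ?(ltW h0)//.
  apply: le_trans (expR_ge1Dx _); rewrite -[m.+1%:R]natr1.
  have k : 0 <= (g / 4 - h) * m%:R by rewrite mulr_ge0 ?subr_ge0.
  by lra.
have -> : C0 * (m.+1%:R ^+ 3 * expR (C1 - g * m%:R)) =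
    C0 * expR C1 * m.+1%:R ^+ 3 / expR (g * m%:R) by rewrite expRB; ring.
rewrite ler_pdivrMr ?expR_gt0//.
apply: (@le_trans _ _ (a * (h * m.+1%:R) ^+ 4)); last by rewrite ler_pM2l.
have : C0 * expR C1 <= m.+1%:R * (h ^+ 4 * a).
  rewrite -ler_pdivrMr ?mulr_gt0 ?exprn_gt0//; apply: le_trans Dm _.
  by rewrite ler_nat.
move=> /(ler_wpM2r (exprn_ge0 3 (ltW m1))) k.
by lra.
Qed.

Lemma sum_sgn_sat (p m n : nat) (B : 'M['F_p]_(m, n)) (S : 'I_m -> {set 'F_p})
    (x : 'cV['F_p]_n) : (0 < m)%N ->
  sat_ratio R B S x = 2^-1 + (\sum_i sgn R (S i) ((B *m x) i ord0)) / m%:R / 2.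
Proof.
move=> m0; have M0 : m%:R != 0 :> R by rewrite pnatr_eq0 -lt0n.
rewrite /sat_ratio -sum1_card natr_sum big_mkcond /=.
have -> : \sum_i sgn R (S i) ((B *m x) i ord0) =
    2 * (\sum_(i < m) if (B *m x) i ord0 \in S i then 1 else 0) - m%:R.
  have -> : m%:R = \sum_(i < m) (1 : R) by rewrite sumr_const card_ord.
  rewrite mulr_sumr -sumrB.
  by apply: eq_bigr => i _; rewrite /sgn; case: ifP => _; ring.
have -> : \sum_i (if i \in [set i | (B *m x) i ord0 \in S i] then (1%N)%:R else 0) =
    \sum_(i < m) (if (B *m x) i ord0 \in S i then 1 else 0) :> R.
  by apply: eq_bigr => i _; rewrite inE.
by field.
Qed.

Lemma exists_sat mu delta l eps : 4^-1 <= mu -> mu < 2^-1 ->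
  0 <= delta <= 2^-1 - mu -> lambda_ok mu l ->
  E_exp mu delta + G_exp mu l < 0 -> 0 < eps ->
  exists2 b : R, 0 < b <= 1 & exists2 c : R, 2 / pi < c <= 1 & exists M : nat,
  forall m n p : nat, (M <= m)%N -> n%:R = 2 * mu * m%:R -> prime p ->
  forall (B : 'M['F_p]_(m, n)) (S : 'I_m -> {set 'F_p}), is_MDS B ->
    (forall i, `|mean (sgn R (S i))| <= b) ->
    (forall i k, k != 0 -> fabs (sgn R (S i)) k <= c) ->
    exists x : 'cV['F_p]_n, SCL_half (mu + delta) - eps <= sat_ratio R B S x.
Proof.
move=> m1 m2 dd okl EG eps0; have /andP[d0 d1] := dd.
pose al := mu + delta; have al1 : 4^-1 <= al by rewrite /al; lra.
have al2 : al <= 2^-1 by rewrite /al; lra.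
(* A quarter of the gap: one [g] is lost in the tilt and one in [c], leaving the rate [- 2 * g]. *)
pose g := - (E_exp mu delta + G_exp mu l) / 4; have g0 : 0 < g by rewrite /g; lra.
have [c c1 lnc] := @exists_base R g g0; have /andP[c2 c3] := c1.
have [y y1 hy] := exists_tilt m1 m2 dd g0; have /andP[y2 y3] := y1.
pose b := Num.min 1 eps / 8.
have b0 : 0 < b by rewrite divr_gt0// lt_min ltr01.
have mn1 : Num.min 1 eps <= 1 by rewrite ge_min lexx.
have mn2 : Num.min 1 eps <= eps by rewrite ge_min lexx orbT.
have b1 : b <= 8^-1 by rewrite /b; lra.
have b2 : b <= eps / 8 by rewrite /b; lra.
have c0 : 0 < c by apply: lt_trans c2; rewrite divr_gt0 ?pi_gt0.
exists b; first by rewrite b0 /=; lra.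
exists c => //.
pose s := Num.sqrt (al * (1 - al)).
have s0 : 0 <= s by exact: sqrtr_ge0.
have sE : s ^+ 2 = al * (1 - al) by rewrite sqr_sqrtr// mulr_ge0//; lra.
have s1 : 2 * s <= 1.
  rewrite -(expr_le1 (n := 2)) ?mulr_ge0// exprMn sE.
  by have := sqr_ge0 (1 - 2 * al); lra.
(* A mean sign of [theta] means satisfaction [1/2 + s - eps / 2]. *)
pose theta := 2 * s - eps.
(* The adjacent pair missing from the window is then a fraction at most [eps / 8] of its length. *)
pose L := (Num.truncn (8 / eps)).+1.
have Leps : 8 <= eps * L%:R.
  by rewrite -ler_pdivrMl// mulrC; apply/ltW/truncnS_gt.
pose K0 := (2 + `|ln al| + `|ln (1 - al)|) * L%:R.
pose K1 := - ln (2 / pi) + (4 + `|ln l| + `|ln (2 * mu - l)| +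
       `|ln (4 * mu - 1 - l)| + `|ln (2 - 6 * mu + l)|).
have [M1 hM1] : exists M : nat, forall m : nat, (M <= m)%N ->
    ((1 + `|theta|) * (2 / c)) * (m.+1%:R ^+ 3 * expR (K0 + K1 - 2 * g * m%:R)) <= eps / 8.
  apply: exp_rate_le; last exact: divr_gt0.
    by rewrite mulr_ge0 ?addr_ge0// divr_ge0// ltW.
  exact: mulr_gt0.
(* From here on the window length is at most the fraction [b] of [al * m]. *)
pose M2 := (Num.truncn (L%:R / (b * al))).+1.
exists (maxn M1 M2) => m n p; rewrite geq_max => /andP[mM1 mM2] nE p_pr B S mdsB hb hc.
have {hM1} := hM1 m mM1; set err := expR _ => herr.
have mL : L%:R <= b * (al * m%:R).
  have bal : 0 < b * al by rewrite mulr_gt0//; lra.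
  rewrite mulrA -ler_pdivrMl//.
  by rewrite mulrC; apply/ltW/(lt_le_trans (truncnS_gt _)); rewrite ler_nat.
have m0 : (0 < m)%N by apply: leq_trans mM2.
have M0 : 0 < m%:R :> R by rewrite ltr0n.
have al0 : 0 < al by lra.
have mu2 : 2 * mu <= 1 by move: m2; clear; lra.
have [m2n nm t2n t_bin] := dual_bound_le m0 nE m1 mu2 okl c1 (ltW g0) lnc.
set t := Num.truncn _ in t2n t_bin * => hdual.
pose l0 := Num.truncn (al * m%:R).
have /andP[l01 l02] := truncn_itv (ltW (mulr_gt0 al0 M0)); rewrite -/l0 -natr1 in l01 l02.
have Ll : (L <= l0.+1)%N.
  rewrite -(ler_nat R) -natr1; apply/ltW/(le_lt_trans mL); apply: le_lt_trans l02.
  by rewrite ger_pMl ?mulr_gt0//; move: b1; clear; lra.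
have lm : (l0 <= m)%N.
  rewrite -(ler_nat R); apply: le_trans l01 _; rewrite ger_pMl//.
  by move: al2; clear; lra.
(* The top level of the window is [l0], the integer part of [al * m]; this is the degree bound for
   [autocorr_le]. *)
pose a := (l0.+1 - L)%N; have aL : (a + L = l0.+1)%N by rewrite subnK.
have aLm : (a + L <= m.+1)%N by rewrite aL ltnS.
have aR : a%:R = l0%:R + 1 - L%:R :> R by rewrite natrB// -natr1.
have L0 : (0 < L)%N by [].
pose v : {set 'I_m} -> R := @window_weight R m L a.
pose V : R := m.+1%:R * expR (m%:R * (xlnx al + xlnx (1 - al)) + K0).
have V0 : 0 <= V by rewrite mulr_ge0 ?expR_ge0.
have vV A : v A <= Num.sqrt V.
  rewrite /v /window_weight /window; case: ifP => [/andP[ka kl]|_]; last exact: sqrtr_ge0.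
  rewrite -sqrtrV ?ler0n// ler_wsqrtr//; rewrite aL ltnS in kl.
  apply: inv_bin_le => //; [exact: leq_trans lm|by move: al1 al2; clear; lra|].
  rewrite -(ler_nat R) aR in ka; rewrite -(ler_nat R) in kl.
  rewrite ler0_norm; move: l01 l02 ka kl; clear; lra.
have v0 A : 0 <= v A by exact: window_ge0.
have vv A A' : v A * v A' <= V.
  by rewrite -[V]sqr_sqrtr// expr2 ler_pM.
have vl (A : {set 'I_m}) : (l0 < #|A|)%N -> v A = 0.
  by move=> h; rewrite /v /window_weight /window aL ltnS [(_ <= l0)%N]leqNgt h andbF.
pose P := V * ((2 * y) ^+ n * (1 + y ^+ 2) ^+ (m - n)) / y ^+ (2 * l0).
have y20 : 0 < y ^+ (2 * l0) by rewrite exprn_gt0.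
have hP (T : {set 'I_m}) : (n <= #|T|)%N -> autocorr v T <= P.
  move=> nT; rewrite /P ler_pdivlMr// mulrC.
  by have := autocorr_le y1 V0 vv vl nT; rewrite card_ord.
have P_le : P <= m.+1%:R * expR (K0 + m%:R * (E_exp mu delta + g)).
  rewrite /P -mulrA; apply: le_trans (ler_wpM2l V0 (tilt_exp_le m0 nE nm l01 y1)) _.
  rewrite /V -[leLHS]mulrA -expRD ler_pM2l ?ltr0n// ler_expR.
  rewrite E_expE//; last by lra.
  rewrite H_sum.
  have e2 : xlnx (2 * mu) = 2 * mu * ln 2 + 2 * xlnx mu.
    by rewrite xlnxM//; [rewrite /xlnx; ring|lra].
  have e3 : 1 - mu - delta = 1 - al by rewrite /al; ring.
  have := ler_wpM2l (ltW M0) hy; rewrite -/al e2 e3 => h.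
  by move: h; clear; lra.
have P0 : 0 <= P.
  apply: divr_ge0; last exact: ltW.
  apply: mulr_ge0 => //; apply: mulr_ge0; apply: exprn_ge0.
    by rewrite mulr_ge0 ?(ltW y2).
  by rewrite addr_ge0 ?sqr_ge0.
have D0 : 0 <= dual_bound m n c t.
  apply: divr_ge0 => //; apply: mulr_ge0 => //; apply: mulr_ge0; apply: exprn_ge0 => //.
  exact: ltW.
have PD : P * dual_bound m n c t <= m.+1%:R ^+ 3 * err.
  apply: le_trans (ler_pM P0 D0 P_le hdual) _.
  rewrite mulrACA -expRD -exprS le_eqVlt; apply/orP; left; apply/eqP.
  by congr (_ * expR _); rewrite -/K1 /g; field.
have herr2 : (1 + `|theta|) * (2 * P * dual_bound m n c t / c) <= eps / 8.
  apply: le_trans herr; rewrite -[leRHS]mulrA; apply: ler_wpM2l; first exact: addr_ge0.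
  have -> : 2 * P * dual_bound m n c t / c = 2 / c * (P * dual_bound m n c t) by ring.
  by apply: ler_wpM2l => //; rewrite divr_ge0// ltW.
pose q := 2 * (L.-1)%:R * ((1 - b) * s).
have r0 : 0 <= (1 - b) * s by rewrite mulr_ge0//; lra.
have hq i : q <= autocorr v [set i].
  apply: autocorr_window1 => // k ak kaL; rewrite aL ltnS in kaL.
  rewrite exprMn sE.
  have k1 : (1 - al) * m%:R <= (m - k)%:R.
    rewrite natrB; last by apply: leq_trans lm; exact: ltnW.
    have : k%:R <= l0%:R :> R by rewrite ler_nat ltnW.
    by move: l01; clear; lra.
  have k2 : (1 - b) ^+ 2 * (al * m%:R) <= k.+1%:R.
    have : a%:R <= k%:R :> R by rewrite ler_nat.
    rewrite aR -natr1 => h.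
    have h2 : 0 <= b * (1 - b) * (al * m%:R).
      apply: mulr_ge0; apply: mulr_ge0; [exact: ltW| |exact: ltW|exact: ltW].
      by move: b1; clear; lra.
    by move: mL l02 h h2; clear; lra.
  have k3 : 0 <= (1 - al) * m%:R by apply: mulr_ge0; [move: al2; clear; lra|exact: ltW].
  have k4 : 0 <= (1 - b) ^+ 2 * (al * m%:R).
    by apply: mulr_ge0; [exact: sqr_ge0|apply: mulr_ge0; exact: ltW].
  by have := ler_pM k3 k4 k1 k2; clear; lra.
have q0 : 0 <= q by rewrite mulr_ge0// mulr_ge0.
have [/existsP[x hx]|] := boolP [exists x : 'cV['F_p]_n,
    theta * m%:R < \sum_i sgn R (S i) ((B *m x) i ord0)].
  exists x; rewrite sum_sgn_sat// /SCL_half -/al al2 -/s.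
  have : theta <= (\sum_i sgn R (S i) ((B *m x) i ord0)) / m%:R.
    by rewrite ler_pdivlMr// ltW.
  by rewrite /theta; move: eps0; clear; lra.
(* If every sign sum were at most [theta * m], then [weight_avg_ineq] would give [2 * (L - 1) * (1 -
   b) ^+ 2 * s <= (2 * s - eps + b) * L + eps / 8], which the choice of [b] and [L] rules out. *)
rewrite negb_exists => /forallP hall; exfalso.
have c01 : 0 < c <= 1 by rewrite c0.
have b1' : b <= 1 by lra.
have := @weight_avg_ineq R p p_pr m n B S mdsB v P c t m2n t2n v0 hP c01 hc t_bin
  b theta q m0 hb hq q0 b1'.
rewrite autocorr_window0// => k.
have {k} : q * (1 - b) <= (theta + b) * L%:R + eps / 8.
  apply: le_trans (k _) _; last by rewrite lerD2l.
  by move=> x; rewrite leNgt; exact: hall.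
have L1 : 1 <= L%:R :> R by rewrite ler1n.
rewrite /q -subn1 natrB//.
rewrite /theta; move: L1 Leps s0 s1 b0 b1 b2 eps0; clear.
clearbody b s; move: (L%:R : R) => N L1 Leps s0 s1 b0 b1 b2 eps0 k.
have bN : b * N <= eps / 8 * N by rewrite ler_wpM2r//; lra.
have u1 : 0 <= (N - 1) * (b * b) * s by rewrite !mulr_ge0//; lra.
have u2 : 0 <= b * s by rewrite mulr_ge0//; lra.
have u3 : 0 <= (1 - 2 * s) * (b * N) by rewrite !mulr_ge0//; lra.
have u4 : eps <= eps * N by rewrite ler_peMr//; lra.
by lra.
Qed.
End Assembly.

(** For odd [p] the integer [2 * s - p] is not 0, so the density misses one half by at least
    [1 / (2 * p)]. *)
Lemma odd_density_gap (R : realType) (p N s : nat) (eta : R) : odd p ->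
  eta <= (2 * N%:R)^-1 -> (0 < N)%N -> `|s%:R / p%:R - 2^-1| <= eta -> (N <= p)%N.
Proof.
move=> p_odd eN N0 h.
have p0 : 0 < p%:R :> R by rewrite ltr0n odd_gt0.
have NR : 0 < N%:R :> R by rewrite ltr0n.
have k : 1 <= `|2 * s%:R - p%:R| :> R.
  have [e|e|e] := ltngtP (2 * s)%N p.
  - rewrite ler0_norm ?opprB; last by rewrite subr_le0 -natrM ler_nat ltnW.
    by rewrite lerBrDl -natrM natr1 ler_nat.
  - rewrite ger0_norm; last by rewrite subr_ge0 -natrM ler_nat ltnW.
    by rewrite lerBrDl -natrM natr1 ler_nat.
  by move: p_odd; rewrite -e mul2n odd_double.
rewrite -(ler_nat R).
have e : `|2 * s%:R - p%:R| = 2 * p%:R * `|s%:R / p%:R - 2^-1| :> R.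
  rewrite -[2 * p%:R]gtr0_norm ?mulr_gt0// -normrM; congr `|_|; field.
  exact: lt0r_neq0.
have h2 : 1 <= 2 * p%:R * (2 * N%:R)^-1 :> R.
  apply: le_trans k _; rewrite e ler_wpM2l ?mulr_ge0 ?(ltW p0)//.
  exact: le_trans eN.
by move: h2; rewrite ler_pdivlMr ?mulr_gt0// mul1r ler_pM2l.
Qed.

Theorem theorem1p6 (R : realType) (mu : R) (hmu : 0 <= 2 * mu <= 1) :
  (forall delta lambda : R,
     0 <= delta <= 2^-1 - mu ->
     lambda_ok mu lambda ->
     E_exp mu delta + G_exp mu lambda < 0 ->
     forall eps : R, 0 < eps ->
     exists eta : R, 0 < eta /\
     exists M : nat,
     forall m n p : nat,
       (M <= m)%N ->
       n%:R = 2 * mu * m%:R ->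
       prime p ->
       forall (B : 'M['F_p]_(m, n)) (S : 'I_m -> {set 'F_p}),
         is_MDS B ->
         (forall i : 'I_m, `|#|S i|%:R / p%:R - 2^-1| <= eta) ->
         exists x : 'cV['F_p]_n,
           SCL_half (mu + delta) - eps <= sat_ratio R B S x)
  /\
  ((mu = 0 \/ 4^-1 <= mu) ->
   forall lambda : R, is_G_minimizer mu lambda <-> lambda = lambda_star mu).
Proof.
split; last by move=> hmu' lambda; exact: lambda_star_min.
move=> delta lambda hdelta okl EG eps eps0; have /andP[mu0 mu1] := hmu.
have mu_ge0 : 0 <= mu by lra.
have [m14|m14] := ltP mu 4^-1.
  by have := E_G_ge0_small mu_ge0 m14 hdelta okl; rewrite leNgt EG.
have [m12|m12] := leP 2^-1 mu.
  (* At [mu = 1/2] the matrix is square and invertible, so any nonempty sets can be hit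
     simultaneously; [eta = 1/4] keeps them nonempty. *)
  exists 4^-1; split; first by rewrite invr_gt0.
  exists 1%N => m n p m0 nE p_pr B S mdsB hS.
  have {nE} nE : n = m.
    by apply/eqP; rewrite -(eqr_nat R) nE (_ : 2 * mu = 1) ?mul1r//; lra.
  rewrite {n}nE in B mdsB *.
  have S0 i : (0 < #|S i|)%N.
    rewrite lt0n; apply/negP => /eqP e; have := hS i; rewrite e mul0r sub0r normrN.
    by rewrite gtr0_norm ?invr_gt0//; lra.
  have [x hx] := MDS_square_sat R m0 mdsB S0.
  exists x; rewrite hx; have -> : mu = 2^-1 by lra.
  have -> : delta = 0 by case/andP: hdelta => *; lra.
  rewrite addr0 /SCL_half lexx.
  have -> : 2^-1 * (1 - 2^-1) = 2^-1 ^+ 2 :> R by field.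
  by rewrite sqrtr_sqr ger0_norm ?invr_ge0//; lra.
have [b /andP[b0 b1] [c /andP[c1 c2] [M1 hM1]]] := exists_sat m14 m12 hdelta okl EG eps0.
have [P0 hP0] := sin_ratio_limit c1.
(* The mean of a sign is twice the density defect, hence [b / 2]; the second bound forces [p] beyond
   [P0]. *)
pose eta := Num.min (b / 2) (2 * P0.+1%:R)^-1.
have eta1 : eta <= b / 2 by rewrite ge_min lexx.
have eta2 : eta <= (2 * P0.+1%:R)^-1 by rewrite ge_min lexx orbT.
exists eta; split; first by rewrite lt_min divr_gt0// invr_gt0 mulr_gt0.
(* [M2] yields [n.+2 <= m], and [4 <= m] yields [2 <= n] because [mu >= 1/4]; together they exclude
   [p = 2]. *)
pose M2 := (Num.truncn (2 / (1 - 2 * mu))).+1.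
exists (maxn M1 (maxn M2 4)) => m n p; rewrite !geq_max => /and3P[mM1 mM2 m4] nE p_pr B S mdsB hS.
have [p2|p_odd] := even_prime p_pr.
  exfalso; have n2 : (n.+2 <= m)%N.
    rewrite -(ler_nat R) -addn2 natrD nE.
    have : 2 / (1 - 2 * mu) <= m%:R.
      by apply/ltW/(lt_le_trans (truncnS_gt _)); rewrite ler_nat.
    rewrite ler_pdivrMr; lra.
  subst p.
  have : (2 <= n)%N.
    rewrite -(ler_nat R) nE; have : 4 <= m%:R :> R by rewrite ler_nat.
    nra.
  by rewrite leqNgt (MDS_F2 mdsB n2).
have [i0|i0] := posnP m; first by rewrite i0 in m4.
have pP0 : (P0.+1 <= p)%N.
  exact: (odd_density_gap p_odd eta2 (ltn0Sn P0) (hS (Ordinal i0))).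
apply: (hM1 m n p mM1 nE p_pr B S mdsB) => [i|i k k0].
  rewrite mean_sgn// normrM ger0_norm//; have := hS i; lra.
apply: le_trans (fabs_sign_le R p_pr (S i) k0) _.
by apply: hP0; exact: ltnW.
Qed.
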